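(* Let $M^3$ be a Lagrangian submanifold of the homogeneous nearly Kähler sphere $\mathbb S^6(1)$. Then, at every point, $$|A|^2\le\tfrac5{12}\,s|T|^2,$$ $$\langle A,S\rangle^2\le\tfrac1{12}\,(-4s^3+17sq-15r)\,|T|^2 .$$
   Context: Everything is smooth. Identify $\mathbb R^7$ with the imaginary Cayley numbers with cross product $X\times Y=\tfrac12(XY-YX)$. The homogeneous nearly Kähler structure on $\mathbb S^6(1)\subset\mathbb R^7$ is the round metric $\langle\cdot,\cdot\rangle$ with $J_xX=x\times X$. Let $\overline\nabla$ be its Levi-Civita connection and $G(X,Y)=(\overline\nabla_XJ)Y$. A Lagrangian submanifold is an immersed 3-manifold $M^3$ with the induced metric such that $J(TM)=T^\perp M$. Let $\nabla,\nabla^\perp$ be the Levi-Civita and normal connections, $h(X,Y)=\overline\nabla_XY-\nabla_XY$ the second fundamental form, and $A_\xi$ the shape operator, $\langle A_\xi X,Y\rangle=\langle h(X,Y),\xi\rangle$. It is known that $M$ is orientable and minimal and that $G(X,Y)$ is normal for tangent $X,Y$. The form $\omega(X,Y,Z)=\langle G(X,Y),JZ\rangle$ is the volume form of $M$ for a suitable orientation, which is fixed. In a local oriented orthonormal frame $\{e_1,e_2,e_3\}$: $\omega_{ijk}=\omega(e_i,e_j,e_k)$ (so $\omega_{123}=1$); $h_{ijk}=\langle h(e_i,e_j),Je_k\rangle$ (known to be totally symmetric and trace-free); $S_{ij}=\sum_{a,b}h_{abi}h_{abj}$, $s=|h|^2=\operatorname{tr}S$, $q=\operatorname{tr}(S^2)$,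 $r=\operatorname{tr}(S^3)$. Set $(\nabla h)(X,Y,Z)=\nabla^\perp_Xh(Y,Z)-h(\nabla_XY,Z)-h(Y,\nabla_XZ)$ and $$T(X,Y,Z)=(\nabla h)(X,Y,Z)-\tfrac14\{G(X,A_{JZ}Y)+G(Y,A_{JX}Z)+G(Z,A_{JY}X)\},$$ $T_{lijk}=\langle T(e_l,e_i,e_j),Je_k\rangle$ (a totally symmetric trace-free tensor), $|T|^2=\sum_{l,i,j,k} T_{lijk}^2$. Define $$P_{ijk}=\sum_{a,b}h_{abi}T_{abjk},\quad W_{ij}=\sum_{a,b}\omega_{iab}P_{abj},\quad A_{ij}=\tfrac12(W_{ij}+W_{ji}),$$ with $|A|^2=\sum_{i,j}A_{ij}^2$, $\langle A,S\rangle=\sum_{i,j}A_{ij}S_{ij}$. (The matrix $A=(A_{ij})$ is not to be confused with the shape operator $A_\xi$.) *)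

(* Defs.v *)
From HB Require Import structures.
From mathcomp Require Import all_boot all_order all_algebra.
From mathcomp Require Import all_classical all_reals all_analysis.
Set Implicit Arguments.
Unset Strict Implicit.
Unset Printing Implicit Defensive.
Import Order.TTheory GRing.Theory Num.Theory.
Import numFieldNormedType.Exports.
Local Open Scope classical_set_scope.
Local Open Scope ring_scope.

Section Cayley.
Variable R : realType.

(* Cayley-Dickson doubling: (a, b)(c, d) = (ac - d^* b, da + b c^* ) and
   (a, b)^* = (a^*, - b). *)
Definition cd_mul (A : zmodType) (mul : A -> A -> A) (conj : A -> A)
    (x y : A * A) : A * A :=
  (mul x.1 y.1 - mul (conj y.2) x.2, mul y.2 x.1 + mul x.2 (conj y.1)).

Definition cd_conj (A : zmodType) (conj : A -> A) (x : A * A) : A * A :=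
  (conj x.1, - x.2).

Definition complex2 : zmodType := (R * R)%type.
Definition quaternion : zmodType := (complex2 * complex2)%type.
Definition cayley : zmodType := (quaternion * quaternion)%type.

Definition complex2_mul : complex2 -> complex2 -> complex2 :=
  @cd_mul R *%R idfun.
Definition complex2_conj : complex2 -> complex2 := @cd_conj R idfun.
Definition quaternion_mul : quaternion -> quaternion -> quaternion :=
  cd_mul complex2_mul complex2_conj.
Definition quaternion_conj : quaternion -> quaternion := cd_conj complex2_conj.
Definition cayley_mul : cayley -> cayley -> cayley :=
  cd_mul quaternion_mul quaternion_conj.

Definition im_cayley (v : 'rV[R]_7) : cayley :=
  let c k := v 0 (inord k) in
  (((0, c 0%N), (c 1%N, c 2%N)), ((c 3%N, c 4%N), (c 5%N, c 6%N))).

Definition im_coords (x : cayley) : 'rV[R]_7 :=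
  \row_(k < 7) nth (0 : R) [:: x.1.1.2; x.1.2.1; x.1.2.2;
                         x.2.1.1; x.2.1.2; x.2.2.1; x.2.2.2] k.

Definition cross (u v : 'rV[R]_7) : 'rV[R]_7 :=
  2^-1 *: im_coords (cayley_mul (im_cayley u) (im_cayley v)
                     - cayley_mul (im_cayley v) (im_cayley u)).

Definition dot (n : nat) (u v : 'rV[R]_n) : R := \sum_i u 0 i * v 0 i.

End Cayley.

Section Manifold.
Variable R : realType.

(* C^infinity on U: every iterated directional derivative is Frechet
   differentiable at the points of U. *)
Definition smooth_on (m n : nat) (U : set 'rV[R]_m.+1)
    (f : 'rV[R]_m.+1 -> 'rV[R]_n.+1) : Prop :=
  forall (vs : seq 'rV[R]_m.+1) (u : 'rV[R]_m.+1), U u ->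
    differentiable (foldr (fun v g => 'D_v g) f vs) u.

Record chart (M : topologicalType) (n : nat) : Type := Chart {
  chart_dom : set M;
  chart_map : M -> 'rV[R]_n.+1;
  chart_inv : 'rV[R]_n.+1 -> M;
  chart_dom_open : open chart_dom;
  chart_img_open : open (chart_map @` chart_dom);
  chart_mapK : forall x, chart_dom x -> chart_inv (chart_map x) = x;
  chart_map_continuous : {within chart_dom, continuous chart_map};
  chart_inv_continuous :
    {within chart_map @` chart_dom, continuous chart_inv} }.

Definition chart_img (M : topologicalType) (n : nat) (c : chart M n) :=
  chart_map c @` chart_dom c.

(* n.+1 is the dimension. *)
Definition smooth_atlas (M : topologicalType) (n : nat)
    (atlas : set (chart M n)) : Prop :=
  (forall x : M, exists2 c, atlas c & chart_dom c x) /\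
  (forall c d, atlas c -> atlas d ->
     smooth_on (chart_map c @` (chart_dom c `&` chart_dom d))
               (chart_map d \o chart_inv c)).

Definition smooth_manifold (M : topologicalType) (n : nat)
    (atlas : set (chart M n)) : Prop :=
  [/\ hausdorff_space M, @second_countable M & smooth_atlas atlas].

End Manifold.

(* The geometry of an immersion f of an open subset of R^3 into S^6, namely of
   F \o chart_inv c for an immersion F and a chart c.  A tangent field of M is
   given by its components X : R^3 -> R^3 in the chart; a section of the
   pull-back of T(S^6) is a map V : R^3 -> R^7 with <V, f> = 0. *)
Section Immersion.
Variable R : realType.
Variable f : 'rV[R]_3 -> 'rV[R]_7.
Implicit Types (X Y Z : 'rV[R]_3 -> 'rV[R]_3) (V xi : 'rV[R]_3 -> 'rV[R]_7).
Implicit Types u : 'rV[R]_3.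

Definition coord_vec (i : 'I_3) : 'rV[R]_3 := delta_mx 0 i.

Definition push X : 'rV[R]_3 -> 'rV[R]_7 := fun u => 'D_(X u) f u.

Definition cplx V : 'rV[R]_3 -> 'rV[R]_7 := fun u => cross (f u) (V u).

(* Levi-Civita connection of the round sphere: the component tangent to S^6
   of the flat derivative. *)
Definition nabla_bar X V : 'rV[R]_3 -> 'rV[R]_7 :=
  fun u => 'D_(X u) V u - dot ('D_(X u) V u) (f u) *: f u.

(* (nabla_bar_X J) V *)
Definition nablaJ X V : 'rV[R]_3 -> 'rV[R]_7 :=
  fun u => nabla_bar X (cplx V) u - cplx (nabla_bar X V) u.

Definition G X Y : 'rV[R]_3 -> 'rV[R]_7 := nablaJ X (push Y).

Definition metric u : 'M[R]_3 :=
  \matrix_(i, j) dot ('D_(coord_vec i) f u) ('D_(coord_vec j) f u).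

Definition christoffel u (k i j : 'I_3) : R :=
  2^-1 * \sum_l invmx (metric u) k l *
    ('D_(coord_vec i) (fun w => metric w j l) u
     + 'D_(coord_vec j) (fun w => metric w i l) u
     - 'D_(coord_vec l) (fun w => metric w i j) u).

(* Levi-Civita connection of the induced metric. *)
Definition nabla X Y : 'rV[R]_3 -> 'rV[R]_3 :=
  fun u => 'D_(X u) Y u
    + \row_k \sum_i \sum_j christoffel u k i j * X u 0 i * Y u 0 j.

Definition sff X Y : 'rV[R]_3 -> 'rV[R]_7 :=
  fun u => nabla_bar X (push Y) u - push (nabla X Y) u.

(* The components of the tangent vector dual, for the induced metric, to the
   covector with components b. *)
Definition sharp u (b : 'rV[R]_3) : 'rV[R]_3 := b *m invmx (metric u).

Definition tan_part V : 'rV[R]_3 -> 'rV[R]_3 :=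
  fun u => sharp u (\row_j dot (V u) ('D_(coord_vec j) f u)).

Definition nabla_perp X xi : 'rV[R]_3 -> 'rV[R]_7 :=
  fun u => nabla_bar X xi u - push (tan_part (nabla_bar X xi)) u.

Definition shape xi X : 'rV[R]_3 -> 'rV[R]_3 :=
  fun u => sharp u (\row_j dot (sff X (cst (coord_vec j)) u) (xi u)).

Definition nabla_sff X Y Z : 'rV[R]_3 -> 'rV[R]_7 :=
  fun u => nabla_perp X (sff Y Z) u
    - sff (nabla X Y) Z u - sff Y (nabla X Z) u.

Definition J X : 'rV[R]_3 -> 'rV[R]_7 := cplx (push X).

Definition Tfield X Y Z : 'rV[R]_3 -> 'rV[R]_7 :=
  fun u => nabla_sff X Y Z u
    - 4^-1 *: (G X (shape (J Z) Y) u + G Y (shape (J X) Z) u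
               + G Z (shape (J Y) X) u).

Definition omega X Y Z : 'rV[R]_3 -> R := fun u => dot (G X Y u) (J Z u).

(* J (TM) is the orthogonal complement of TM in T(S^6). *)
Definition lagrangian_at u : Prop :=
  forall v : 'rV[R]_7,
    (exists a : 'rV[R]_3, v = cross (f u) ('D_a f u)) <->
    (dot v (f u) = 0 /\ forall b : 'rV[R]_3, dot v ('D_b f u) = 0).

Definition frame := 'I_3 -> 'rV[R]_3 -> 'rV[R]_3.

(* Positivity refers to the orientation of M given by omega. *)
Definition oriented_orthonormal_frame (V : set 'rV[R]_3) (e : frame) : Prop :=
  [/\ forall i, smooth_on V (e i),
      forall u, V u -> forall i j,
        dot (push (e i) u) (push (e j) u) = (i == j)%:R &
      forall u, V u ->
        0 < omega (e (inord 0)) (e (inord 1)) (e (inord 2)) u].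

Section Frame.
Variables (e : frame) (u : 'rV[R]_3).

Definition omega_c (i j k : 'I_3) : R := omega (e i) (e j) (e k) u.

Definition h_c (i j k : 'I_3) : R := dot (sff (e i) (e j) u) (J (e k) u).

Definition S_mx : 'M[R]_3 :=
  \matrix_(i, j) \sum_a \sum_b h_c a b i * h_c a b j.

Definition s_inv : R := \tr S_mx.
Definition q_inv : R := \tr (S_mx *m S_mx).
Definition r_inv : R := \tr (S_mx *m S_mx *m S_mx).

Definition T_c (l i j k : 'I_3) : R :=
  dot (Tfield (e l) (e i) (e j) u) (J (e k) u).

Definition T_norm2 : R := \sum_l \sum_i \sum_j \sum_k T_c l i j k ^+ 2.

Definition P_c (i j k : 'I_3) : R :=
  \sum_a \sum_b h_c a b i * T_c a b j k.

Definition W_c (i j : 'I_3) : R :=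
  \sum_a \sum_b omega_c i a b * P_c a b j.

Definition A_mx : 'M[R]_3 := \matrix_(i, j) (2^-1 * (W_c i j + W_c j i)).

End Frame.
End Immersion.

Definition mx_inner (R : realType) (n : nat) (B C : 'M[R]_n) : R :=
  \sum_i \sum_j B i j * C i j.

(* No injectivity of F is required. *)
Definition lagrangian_immersion (R : realType) (M : topologicalType)
    (atlas : set (chart R M 2)) (F : M -> 'rV[R]_7) : Prop :=
  (forall x : M, dot (F x) (F x) = 1) /\
  forall c, atlas c ->
    smooth_on (chart_img c) (F \o chart_inv c) /\
    forall u, chart_img c u ->
      injective (fun a => 'D_a (F \o chart_inv c) u) /\
      lagrangian_at (F \o chart_inv c) u.

(* Main.v *)
Require Import Defs.
From HB Require Import structures.
From mathcomp Require Import all_boot all_order all_algebra.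
From mathcomp Require Import all_classical all_reals all_analysis.
From mathcomp Require Import ring lra.
Set Implicit Arguments.
Unset Strict Implicit.
Unset Printing Implicit Defensive.
Import Order.TTheory GRing.Theory Num.Theory.
Import numFieldNormedType.Exports.
Local Open Scope classical_set_scope.
Local Open Scope ring_scope.

(* Along a local oriented orthonormal frame e_i, write E_i for its image in R^7
   and N_i = f x E_i = J e_i, so that f, E_i, N_i is an orthonormal basis of R^7.
   Differentiating <E_j, N_k> = 0 gives h_ijk - h_ikj = <E_i x E_j, E_k>; summing
   cyclically, both sides vanish.  Hence h is symmetric, E_i x E_j is the sum of
   the omega_ijk N_k, and differentiating <E_0 x E_1, E_2> = 0 gives minimality.
   The Codazzi equation follows from the symmetry of second derivatives, and makes
   T symmetric and trace-free.

   What remains is algebra.  For a symmetric matrix B one has <A, B> = <L, T>,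
   where L = L(h, B) is the trace-free symmetric part of
   (c, d, b, j) |-> sum_(i, a) omega_iab B_ij h_cda, so that
   <A, B>^2 <= |L|^2 |T|^2 by Cauchy-Schwarz.  For B = S, |L|^2 is exactly
   (-4 s^3 + 17 s q - 15 r) / 12.  For trace-free B, 5/12 s |B|^2 - |L|^2 is a
   combination with positive coefficients of the squared norms of other
   SO(3)-equivariant parts of h (x) B, and B = A gives the first inequality. *)

(** * The cross product of R^7 *)

Section Cross.
Variable R : realType.
Implicit Types u v w x y a b c : 'rV[R]_7.

Lemma ord7_inord (P : 'I_7 -> Prop) :
  P (inord 0) -> P (inord 1) -> P (inord 2) -> P (inord 3) ->
  P (inord 4) -> P (inord 5) -> P (inord 6) -> forall i, P i.
Proof.
move=> p0 p1 p2 p3 p4 p5 p6 i; rewrite -(inord_val i).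
by case: i => -[|[|[|[|[|[|[|//]]]]]]] /= _.
Qed.

Lemma sum7E (F : 'I_7 -> R) : \sum_i F i =
  F (inord 0) + F (inord 1) + F (inord 2) + F (inord 3) + F (inord 4)
  + F (inord 5) + F (inord 6).
Proof.
rewrite !big_ord_recl big_ord0 addr0 !addrA.
by do 7?[congr (_ + _)]; congr F; apply: val_inj; rewrite /= inordK.
Qed.

Lemma crossE u v :
  let m i j := u 0 (inord i) * v 0 (inord j) - u 0 (inord j) * v 0 (inord i) in
  cross u v = \row_(k < 7) nth 0
    [:: m 1 2 + m 3 4 + m 6 5;
        m 2 0 + m 3 5 + m 4 6;
        m 0 1 + m 3 6 + m 5 4;
        m 4 0 + m 5 1 + m 6 2;
        m 0 3 + m 6 1 + m 2 5;
        m 0 6 + m 1 3 + m 4 2;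
        m 5 0 + m 1 4 + m 2 3] k.
Proof.
move=> m; apply/rowP; apply: ord7_inord;
  by rewrite !mxE !inordK//= /m; field.
Qed.

(** Gives all seven coordinates one polynomial shape, so that the product rule for [cross] is proved
    once and not coordinate by coordinate. *)
Lemma cross_coordE k : exists i1 j1 i2 j2 i3 j3 : 'I_7, forall u v,
  cross u v 0 k = u 0 i1 * v 0 j1 - u 0 j1 * v 0 i1
    + (u 0 i2 * v 0 j2 - u 0 j2 * v 0 i2) + (u 0 i3 * v 0 j3 - u 0 j3 * v 0 i3).
Proof.
by move: k; apply: ord7_inord; do 6!eexists; move=> u v;
  rewrite crossE mxE inordK//=.
Qed.

Lemma crossC u v : cross u v = - cross v u.
Proof.
by rewrite !crossE; apply/rowP; apply: ord7_inord; rewrite !mxE !inordK//=; ring.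
Qed.

Lemma crossDl u u' v : cross (u + u') v = cross u v + cross u' v.
Proof.
by rewrite !crossE; apply/rowP; apply: ord7_inord; rewrite !mxE !inordK//=; ring.
Qed.

Lemma crossZl k u v : cross (k *: u) v = k *: cross u v.
Proof.
by rewrite !crossE; apply/rowP; apply: ord7_inord; rewrite !mxE !inordK//=; ring.
Qed.

Lemma dot_crossC u v w : dot (cross u v) w = dot (cross v w) u.
Proof.
by rewrite /dot !sum7E !crossE !mxE !inordK//=; ring.
Qed.

(** Polarisation in x of <x × a, x × b> = |x|^2 <a, b> - <x, a> <x, b>. In R^7 only this symmetrised
    form holds for distinct x and y. *)
Lemma dot_cross_cross x y a b :
  dot (cross x a) (cross y b) + dot (cross y a) (cross x b) =
  2 * dot x y * dot a b - dot x a * dot y b - dot y a * dot x b.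
Proof.
by rewrite /dot !sum7E !crossE !mxE !inordK//=; ring.
Qed.

End Cross.

(** * Symmetry of second derivatives *)

Section Calculus.
Variable R : realType.
Implicit Types (U V W : normedModType R).

Lemma derive_comp_affine V (f : V -> R) (a v : V) (t : R) :
  differentiable f (a + t *: v) ->
  is_derive t 1 (fun s => f (a + s *: v)) ('D_v f (a + t *: v)).
Proof.
move=> df.
pose g (s : R) := a + s *: v.
have gd : is_diff t g ( *:%R^~ v).
  have -> : g = cst a + ( *:%R^~ v) by apply/funext.
  apply: is_diff_eq.
  by rewrite add0r.
have fd : is_diff (g t) f ('d f (g t)) by apply/differentiableP.
have /= fg := is_diff_comp gd fd.
apply: DeriveDef; first by apply/derivable1_diffP; exact: ex_diff.
rewrite deriveE; last exact: ex_diff.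
rewrite -[fun s : R => _]/(f \o g) diff_val /= scale1r.
by rewrite deriveE.
Qed.

(** The second difference is the increment over [0, t] of [phi] below. The mean value theorem turns
    it into a difference of two values of ['D_v f], and these are compared by the first-order
    expansion of ['D_v f] at u. *)
Lemma second_difference_limit V (f : V -> R) (u v w : V) (e : R) :
  (\forall x \near u, differentiable f x) -> differentiable ('D_v f) u ->
  0 < e ->
  \forall t \near 0^'+, `|f (u + t *: w + t *: v) - f (u + t *: w)
     - (f (u + t *: v) - f u) - t ^+ 2 * 'D_w ('D_v f) u| <= e * t ^+ 2.
Proof.
move=> fd df1 e0.
set f1 : V -> R := 'D_v f in df1 *.
have [_ /eqaddoP df1E] := (diff_locallyP u f1).1 df1.
(* The two displacements t w + c v and c v have total length at most t (2 |v| + |w|); the summand 1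
   only makes [K] positive. *)
pose K := 2 * `|v| + `|w| + 1.
have K0 : 0 < K by rewrite ltr_wpDl// addr_ge0 ?mulr_ge0.
have d0 : 0 < e / K by rewrite divr_gt0.
have : \forall x \near (0 : V),
    differentiable f (u + x) /\ `|f1 (u + x) - f1 u - 'd f1 u x| <= e / K * `|x|.
  near=> x; split; near: x; first by move/nbhs0P: fd.
  have := df1E _ d0; apply: filterS => x /=.
  by rewrite !fctE /= opprD addrA [u + x]addrC.
move=> /nbhs_ballP[r /= r0 rP].
near=> t.
have t0 : 0 < t by [].
have tr : t * K < r.
  rewrite -ltr_pdivlMr//; near: t; apply: nbhs_right_lt; exact: divr_gt0.
have lenx a b : 0 <= a <= t -> 0 <= b <= t ->
    `|a *: w + b *: v| <= a * `|w| + t * `|v|.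
  move=> /andP[a0 at_] /andP[b0 bt].
  rewrite (le_trans (ler_normD _ _))// !normrZ !ger0_norm// lerD2l.
  by rewrite ler_wpM2r.
have inb a b : 0 <= a <= t -> 0 <= b <= t -> ball (0 : V) r (a *: w + b *: v).
  move=> at_ bt; rewrite -ball_normE /= sub0r normrN (le_lt_trans (lenx _ _ _ _))//.
  apply: le_lt_trans tr; rewrite /K !mulrDr mulr1.
  have /andP[a0 at2] := at_.
  have := ler_wpM2r (normr_ge0 w) at2; have := mulr_ge0 (ltW t0) (normr_ge0 v).
  by move: (ltW t0) => *; lra.
have tt : 0 <= t <= t by rewrite ltW/=.
have t00 : 0 <= (0 : R) <= t by rewrite lexx ltW.
pose phi s := f (u + t *: w + s *: v) - f (u + s *: v).
have dphi s : s \in `[0, t] ->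
    is_derive s 1 phi (f1 (u + t *: w + s *: v) - f1 (u + s *: v)).
  rewrite in_itv /= => s0t.
  apply: is_deriveB; apply: derive_comp_affine.
    by rewrite -addrA; apply: (rP _ _).1; exact: inb.
  by have := (rP _ (inb 0 s t00 s0t)).1; rewrite scale0r add0r.
have [|c c0t] := MVT_segment (ltW t0) (fun s st => dphi s (subset_itv_oo_cc st)).
  by apply: derivable_within_continuous => s /dphi [].
rewrite /phi !scale0r !addr0 subr0 => phiE.
rewrite in_itv /= in c0t.
have -> : f (u + t *: w + t *: v) - f (u + t *: w) - (f (u + t *: v) - f u)
   = f (u + t *: w + t *: v) - f (u + t *: v) - (f (u + t *: w) - f u) by ring.
rewrite phiE deriveE//.
have [_] := rP _ (inb t c tt c0t); have [_] := rP _ (inb 0 c t00 c0t).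
have := lenx t c tt c0t; have := lenx 0 c t00 c0t.
rewrite scale0r mul0r !add0r addrA.
rewrite (_ : 'd f1 u (t *: w + c *: v) = t * 'd f1 u w + 'd f1 u (c *: v)); last first.
  by rewrite linearD; congr (_ + _); rewrite linearZ.
move=> l1 l2 b1 b2.
set A := f1 _ in b2 *; set B := f1 _ in b1 *.
have -> : (A - B) * t - t ^+ 2 * 'd f1 u w =
  t * ((A - f1 u - (t * 'd f1 u w + 'd f1 u (c *: v))) -
       (B - f1 u - 'd f1 u (c *: v))) by ring.
rewrite normrM (gtr0_norm t0) expr2 mulrCA ler_pM2l//.
rewrite (le_trans (ler_normB _ _))// (le_trans (lerD b2 b1))// -mulrDr.
rewrite mulrAC ler_pdivrMr// -mulrA ler_pM2l//.
rewrite (le_trans (lerD l2 l1))// /K !mulrDr mulr1.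
by move: (ltW t0) => *; lra.
Unshelve. all: by end_near.
Qed.

(* Young's form of the symmetry of second derivatives: no continuity of the
   second derivatives is needed. *)
Lemma derive_comm V (f : V -> R) (u v w : V) :
  (\forall x \near u, differentiable f x) ->
  differentiable ('D_v f) u -> differentiable ('D_w f) u ->
  'D_w ('D_v f) u = 'D_v ('D_w f) u.
Proof.
move=> fd dv dw; apply/eqP; rewrite -subr_eq0 -normr_le0; apply/ler_addgt0Pr => e e0.
rewrite add0r.
have e2 : 0 < e / 2 by rewrite divr_gt0.
have [t [t0 Hv Hw]] : exists t : R, [/\ 0 < t,
  `|f (u + t *: w + t *: v) - f (u + t *: w)
     - (f (u + t *: v) - f u) - t ^+ 2 * 'D_w ('D_v f) u| <= e / 2 * t ^+ 2 &
  `|f (u + t *: v + t *: w) - f (u + t *: v)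
     - (f (u + t *: w) - f u) - t ^+ 2 * 'D_v ('D_w f) u| <= e / 2 * t ^+ 2].
  have Pv := @second_difference_limit _ _ u v w _ fd dv e2.
  have Pw := @second_difference_limit _ _ u w v _ fd dw e2.
  have [t [[t0 Hv] Hw]] := filter_ex (filterI (filterI (nbhs_right_gt 0) Pv) Pw).
  by exists t; split; [exact: t0|exact: Hv|exact: Hw].
have t20 : 0 < t ^+ 2 by rewrite exprn_gt0.
rewrite -(ler_pM2l t20) -{1}(gtr0_norm t20) -normrM.
(* The second difference is symmetric in v and w, so both bounds estimate the same number. *)
move: Hv Hw; rewrite [u + t *: v + _]addrAC.
move: ('D_w _ _) ('D_v _ _) (f _) (f _) (f _) (f _) => a b x1 x2 x3 x4 Hv Hw.
have -> : t ^+ 2 * (a - b) = (x4 - x2 - (x3 - x1) - t ^+ 2 * b) -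
  (x4 - x3 - (x2 - x1) - t ^+ 2 * a) by ring.
rewrite (le_trans (ler_normB _ _))// (le_trans (lerD Hw Hv))//.
by rewrite -mulrDl -splitr mulrC.
Qed.
End Calculus.

(** * Derivatives of vector-valued maps *)

Section RowCalculus.
Variable R : realType.
Variable V : normedModType R.
Implicit Types (u v : V).

Lemma differentiable_rowP n (g : V -> 'rV[R]_n.+1) u :
  differentiable g u <-> forall i, differentiable (fun w => g w 0 i) u.
Proof.
split=> [dg i|dg].
  rewrite -[fun w => _]/((fun y : 'rV[R]_n.+1 => y 0 i) \o g).
  by apply: differentiable_comp => //; exact: differentiable_coord.
have -> : g = \sum_i (fun w => g w 0 i *: delta_mx 0 i).
  by apply/funext => w; rewrite fct_sumE -row_sum_delta.
by apply: differentiable_sum => i; exact: differentiableZl.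
Qed.

Lemma derive_row n (g : V -> 'rV[R]_n.+1) u v i :
  differentiable g u -> ('D_v g u) 0 i = 'D_v (fun w => g w 0 i) u.
Proof. by move=> dg; rewrite derive_mx ?mxE//; exact: diff_derivable. Qed.

Lemma deriveMd (g h : V -> R) u v : differentiable g u -> differentiable h u ->
  'D_v (fun w => g w * h w) u = g u * 'D_v h u + 'D_v g u * h u.
Proof.
move=> dg dh; rewrite -[fun w => _]/(g * h) deriveM; try exact: diff_derivable.
by rewrite /GRing.scale /= [h u * _]mulrC.
Qed.

Lemma derive_sumd n (h : 'I_n -> V -> R) u v :
  (forall i, differentiable (h i) u) ->
  'D_v (fun w => \sum_i h i w) u = \sum_i 'D_v (h i) u.
Proof.
move=> dh; rewrite -derive_sum; last by move=> i; exact: diff_derivable.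
by rewrite (_ : (fun w => _) = \sum_i h i)//; apply/funext => w; rewrite fct_sumE.
Qed.

Lemma differentiable_sumd (W : normedModType R) n (h : 'I_n -> V -> W) u :
  (forall i, differentiable (h i) u) ->
  differentiable (fun w => \sum_i h i w) u.
Proof.
move=> dh; rewrite (_ : (fun w => _) = \sum_i h i); first exact: differentiable_sum.
by apply/funext => w; rewrite fct_sumE.
Qed.

Lemma differentiable_dot n (g h : V -> 'rV[R]_n.+1) u :
  differentiable g u -> differentiable h u ->
  differentiable (fun w => dot (g w) (h w)) u.
Proof.
move=> /differentiable_rowP dg /differentiable_rowP dh.
by apply: differentiable_sumd => i; exact: differentiableM.
Qed.

Lemma derive_dot n (g h : V -> 'rV[R]_n.+1) u v :
  differentiable g u -> differentiable h u ->
  'D_v (fun w => dot (g w) (h w)) u =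
  dot ('D_v g u) (h u) + dot (g u) ('D_v h u).
Proof.
move=> dg dh.
have /differentiable_rowP dgi := dg; have /differentiable_rowP dhi := dh.
rewrite derive_sumd; last by move=> i; exact: differentiableM.
rewrite /dot -big_split; apply: eq_bigr => i _ /=.
by rewrite deriveMd// !derive_row// addrC.
Qed.

Lemma differentiable_scale n (k : V -> R) (g : V -> 'rV[R]_n.+1) u :
  differentiable k u -> differentiable g u ->
  differentiable (fun w => k w *: g w) u.
Proof.
move=> dk /differentiable_rowP dg; apply/differentiable_rowP => i.
rewrite (_ : (fun w => _) = (fun w => k w * g w 0 i)); first exact: differentiableM.
by apply/funext => w; rewrite mxE.
Qed.

Lemma derive_scale n (k : V -> R) (g : V -> 'rV[R]_n.+1) u v :
  differentiable k u -> differentiable g u ->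
  'D_v (fun w => k w *: g w) u = 'D_v k u *: g u + k u *: 'D_v g u.
Proof.
move=> dk dg; have /differentiable_rowP dgi := dg.
apply/rowP => i; rewrite derive_row; last exact: differentiable_scale.
rewrite (_ : (fun w => _) = (fun w => k w * g w 0 i)); last first.
  by apply/funext => w; rewrite mxE.
by rewrite deriveMd// !mxE derive_row// addrC.
Qed.

Lemma derive_sum_row n m (h : 'I_m -> V -> 'rV[R]_n) u v :
  (forall i, differentiable (h i) u) ->
  'D_v (fun w => \sum_i h i w) u = \sum_i 'D_v (h i) u.
Proof.
move=> dh; rewrite -derive_sum; last by move=> i; exact: diff_derivable.
by rewrite (_ : (fun w => _) = \sum_i h i)//; apply/funext => w; rewrite fct_sumE.
Qed.

Lemma derive_addd (W : normedModType R) (g h : V -> W) u v :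
  differentiable g u -> differentiable h u ->
  'D_v (fun w => g w + h w) u = 'D_v g u + 'D_v h u.
Proof. by move=> dg dh; apply: deriveD; exact: diff_derivable. Qed.

Lemma derive_oppd (W : normedModType R) (g : V -> W) u v :
  differentiable g u -> 'D_v (fun w => - g w) u = - 'D_v g u.
Proof. by move=> dg; apply: deriveN; exact: diff_derivable. Qed.

Lemma differentiable_cross (g h : V -> 'rV[R]_7) u :
  differentiable g u -> differentiable h u ->
  differentiable (fun w => cross (g w) (h w)) u.
Proof.
move=> /differentiable_rowP dg /differentiable_rowP dh.
have dm i j : differentiable (fun w => g w 0 i * h w 0 j - g w 0 j * h w 0 i) u.
  by apply: differentiableB; exact: differentiableM.
apply/differentiable_rowP => k.
have [i1 [j1 [i2 [j2 [i3 [j3 E]]]]]] := @cross_coordE R k.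
rewrite (_ : (fun w => _) = fun w =>
  g w 0 i1 * h w 0 j1 - g w 0 j1 * h w 0 i1
  + (g w 0 i2 * h w 0 j2 - g w 0 j2 * h w 0 i2)
  + (g w 0 i3 * h w 0 j3 - g w 0 j3 * h w 0 i3)).
  by apply: differentiableD (dm _ _); apply: differentiableD; exact: dm.
by apply/funext => w; rewrite E.
Qed.

Lemma derive_cross (g h : V -> 'rV[R]_7) u v :
  differentiable g u -> differentiable h u ->
  'D_v (fun w => cross (g w) (h w)) u =
  cross ('D_v g u) (h u) + cross (g u) ('D_v h u).
Proof.
move=> dg dh; have /differentiable_rowP dgi := dg; have /differentiable_rowP dhi := dh.
have dm i j : differentiable (fun w => g w 0 i * h w 0 j - g w 0 j * h w 0 i) u.
  by apply: differentiableB; exact: differentiableM.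
have dmE i j : 'D_v (fun w => g w 0 i * h w 0 j - g w 0 j * h w 0 i) u =
   ('D_v g u 0 i * h u 0 j - 'D_v g u 0 j * h u 0 i) +
   (g u 0 i * 'D_v h u 0 j - g u 0 j * 'D_v h u 0 i).
  rewrite derive_addd ?derive_oppd ?deriveMd ?derive_row//.
  - by ring.
  - exact: differentiableM.
  - exact: differentiableM.
  - by apply: differentiableN; exact: differentiableM.
apply/rowP => k.
have [i1 [j1 [i2 [j2 [i3 [j3 E]]]]]] := @cross_coordE R k.
rewrite derive_row; last exact: differentiable_cross.
rewrite (_ : (fun w => _) = fun w =>
  g w 0 i1 * h w 0 j1 - g w 0 j1 * h w 0 i1
  + (g w 0 i2 * h w 0 j2 - g w 0 j2 * h w 0 i2)
  + (g w 0 i3 * h w 0 j3 - g w 0 j3 * h w 0 i3)); last first.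
  by apply/funext => w; rewrite E.
rewrite (derive_addd _ (differentiableD (dm i1 j1) (dm i2 j2)) (dm i3 j3)).
rewrite (derive_addd _ (dm i1 j1) (dm i2 j2)) !dmE mxE !E; ring.
Qed.

(** The first-order expansion at u depends only on the germ, so the differential of [g] also serves
    [h]. *)
Lemma differentiable_near (W : normedModType R) (g h : V -> W) u :
  (\near u, g u = h u) -> differentiable g u -> differentiable h u.
Proof.
move=> gh dg; have [dc /eqaddoP dE] := (diff_locallyP u g).1 dg.
have gu : g u = h u by exact: (nbhs_singleton gh).
pose D : {linear V -> W} := 'd g u.
have hE : h \o shift u = cst (h u) + D +o_ (0 : V) id.
  apply/eqaddoP => e e0.
  have gh0 : \forall x \near (0 : V), g (u + x) = h (u + x) by move/nbhs0P: gh.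
  have H := @filterI _ (nbhs (0 : V)) (nbhs_filter (0 : V)) _ _ gh0 (dE _ e0).
  apply: (@filterS _ (nbhs (0 : V)) (nbhs_filter (0 : V)) _ _ _ H) => x [].
  by rewrite !fctE /= [u + x]addrC -gu => ->.
have dhD := diff_unique dc hE.
by apply/diff_locallyP; rewrite dhD; split; [exact: dc|exact: hE].
Qed.

Lemma derive_comm_row n (f : V -> 'rV[R]_n.+1) (u v w : V) :
  (\forall x \near u, differentiable f x) ->
  differentiable ('D_v f) u -> differentiable ('D_w f) u ->
  'D_w ('D_v f) u = 'D_v ('D_w f) u.
Proof.
move=> fd dv dw; apply/rowP => i.
have E z : \near u, 'D_z f u 0 i = 'D_z (fun x => f x 0 i) u.
  by apply: filterS fd => x dx; exact: derive_row.
apply: etrans (derive_row w i dv) _; apply: etrans (near_eq_derive w (E v)) _.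
apply: esym; apply: etrans (derive_row v i dw) _.
apply: etrans (near_eq_derive v (E w)) _; apply: esym.
apply: derive_comm.
- by apply: filterS fd => x dx; exact: (differentiable_rowP f x).1.
- by apply: (differentiable_near (E v)); exact: (differentiable_rowP _ u).1.
- by apply: (differentiable_near (E w)); exact: (differentiable_rowP _ u).1.
Qed.

End RowCalculus.

(** * Bilinearity of the inner product and of the cross product *)

Section Dot.
Variables (R : realType) (n : nat).
Implicit Types u v w : 'rV[R]_n.

Lemma dotC u v : dot u v = dot v u.
Proof. by apply: eq_bigr => i _; rewrite mulrC. Qed.

Lemma dotDl u v w : dot (u + v) w = dot u w + dot v w.
Proof. by rewrite /dot -big_split; apply: eq_bigr => i _; rewrite mxE mulrDl. Qed.

Lemma dotZl k u w : dot (k *: u) w = k * dot u w.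
Proof. by rewrite /dot mulr_sumr; apply: eq_bigr => i _; rewrite mxE mulrA. Qed.

Lemma dot0l w : dot 0 w = 0.
Proof. by rewrite /dot big1// => i _; rewrite mxE mul0r. Qed.

Lemma dotNl u w : dot (- u) w = - dot u w.
Proof. by rewrite -scaleN1r dotZl mulN1r. Qed.

Lemma dotBl u v w : dot (u - v) w = dot u w - dot v w.
Proof. by rewrite dotDl dotNl. Qed.

Lemma dot_suml m (F : 'I_m -> 'rV[R]_n) w :
  dot (\sum_i F i) w = \sum_i dot (F i) w.
Proof.
rewrite /dot exchange_big; apply: eq_bigr => j _.
by rewrite summxE mulr_suml.
Qed.

Lemma dotDr u v w : dot w (u + v) = dot w u + dot w v.
Proof. by rewrite !(dotC w) dotDl. Qed.

Lemma dotZr k u w : dot w (k *: u) = k * dot w u.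
Proof. by rewrite !(dotC w) dotZl. Qed.

Lemma dot_sumr m (F : 'I_m -> 'rV[R]_n) w :
  dot w (\sum_i F i) = \sum_i dot w (F i).
Proof. by rewrite dotC dot_suml; apply: eq_bigr => i _; rewrite dotC. Qed.

End Dot.

Section CrossLinear.
Variable R : realType.
Implicit Types u v w : 'rV[R]_7.

Lemma crossDr u v w : cross w (u + v) = cross w u + cross w v.
Proof. by rewrite !(crossC w) crossDl opprD. Qed.

Lemma crossZr k u w : cross w (k *: u) = k *: cross w u.
Proof. by rewrite !(crossC w) crossZl scalerN. Qed.

Lemma cross0l w : cross 0 w = 0.
Proof. by have := crossZl 0 0 w; rewrite !scale0r. Qed.

Lemma cross_self u : cross u u = 0.
Proof.
have /eqP := crossC u u; rewrite -subr_eq0 opprK -mulr2n -scaler_nat.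
by rewrite scaler_eq0 pnatr_eq0 /= => /eqP.
Qed.

Lemma crossNr u w : cross w (- u) = - cross w u.
Proof. by rewrite -scaleN1r crossZr scaleN1r. Qed.

Lemma cross_sumr m (F : 'I_m -> 'rV[R]_7) w :
  cross w (\sum_i F i) = \sum_i cross w (F i).
Proof.
elim/big_rec2: _ => [|i x y _ <-]; last by rewrite crossDr.
by rewrite crossC cross0l oppr0.
Qed.

End CrossLinear.

(** * Derivatives along vector fields on an open set *)

Section OpenSet.
Variables (R : realType) (m : nat).
Notation U := 'rV[R]_m.+1.
Variable (V : set U).
Hypothesis hV : open V.

Definition diff_on (W : normedModType R) (g : U -> W) :=
  forall u, V u -> differentiable g u.

Definition diff2_on (W : normedModType R) (g : U -> W) :=
  diff_on g /\ forall v, diff_on ('D_v g).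

Definition eq_on (W : Type) (g h : U -> W) := forall u, V u -> g u = h u.

Lemma near_open (P : U -> Prop) u : V u -> (forall w, V w -> P w) -> \near u, P u.
Proof. by move=> Vu VP; apply: filterS (open_nbhs_nbhs (conj hV Vu)). Qed.

Lemma diff_on_eq (W : normedModType R) (g h : U -> W) :
  eq_on g h -> diff_on g -> diff_on h.
Proof.
move=> gh dg u Vu; apply: (differentiable_near (near_open Vu gh)); exact: dg.
Qed.

Lemma derive_eq_on (W : normedModType R) (g h : U -> W) u v :
  V u -> eq_on g h -> 'D_v g u = 'D_v h u.
Proof. by move=> Vu gh; exact: near_eq_derive (near_open Vu gh). Qed.

Lemma derive_cst_on (W : normedModType R) (g : U -> W) k u v :
  V u -> (forall w, V w -> g w = k) -> 'D_v g u = 0.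
Proof.
move=> Vu gk; apply: etrans (derive_cst k u v); exact: derive_eq_on.
Qed.

Lemma derive_dirB (W : normedModType R) (g : U -> W) u v w :
  differentiable g u -> 'D_(v - w) g u = 'D_v g u - 'D_w g u.
Proof. by move=> dg; rewrite !deriveE// linearB. Qed.

Lemma derive_dir_sum (W : normedModType R) (g : U -> W) u l
    (k : 'I_l -> R) (v : 'I_l -> U) :
  differentiable g u ->
  'D_(\sum_i k i *: v i) g u = \sum_i k i *: 'D_(v i) g u.
Proof.
move=> dg; rewrite deriveE// linear_sum; apply: eq_bigr => i _.
by rewrite linearZ deriveE.
Qed.

Lemma derive_dirE (W : normedModType R) (g : U -> W) u (x : U) :
  differentiable g u -> 'D_x g u = \sum_i x 0 i *: 'D_(delta_mx 0 i) g u.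
Proof. by move=> dg; rewrite -derive_dir_sum// -row_sum_delta. Qed.

(* [along X g] is the derivative of [g] along the vector field [X]; it is
   [push g X] when [g] is an immersion. *)
Definition along (W : normedModType R) (X : U -> U) (g : U -> W) : U -> W :=
  fun u => 'D_(X u) g u.

Lemma diff_on_sum (W : normedModType R) l (h : 'I_l -> U -> W) :
  (forall i, diff_on (h i)) -> diff_on (fun w => \sum_i h i w).
Proof. by move=> dh u Vu; apply: differentiable_sumd => i; exact: dh. Qed.

Lemma diff_on_coord n (g : U -> 'rV[R]_n.+1) i :
  diff_on g -> diff_on (fun w => g w 0 i).
Proof. by move=> dg u Vu; apply: (differentiable_rowP g u).1; exact: dg. Qed.

(** A derivative in a varying direction becomes a combination of derivatives in constant directions,
    to which the product rule applies. *)
Lemma along_coord n (X : U -> U) (g : U -> 'rV[R]_n.+1) :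
  diff_on g ->
  eq_on (fun w => \sum_i X w 0 i *: 'D_(delta_mx 0 i) g w) (along X g).
Proof. by move=> dg u Vu; rewrite /along derive_dirE//; exact: dg. Qed.

Lemma diff_along n (X : U -> U) (g : U -> 'rV[R]_n.+1) :
  diff_on X -> diff2_on g -> diff_on (along X g).
Proof.
move=> dX [dg d2g]; apply: diff_on_eq (along_coord X dg) _.
apply: diff_on_sum => i u Vu; apply: differentiable_scale; last exact: d2g.
exact: (diff_on_coord (g := X)).
Qed.

Lemma derive_along n (X : U -> U) (g : U -> 'rV[R]_n.+1) u v :
  V u -> diff_on X -> diff2_on g ->
  'D_v (along X g) u = 'D_('D_v X u) g u
     + \sum_i X u 0 i *: 'D_v ('D_(delta_mx 0 i) g) u.
Proof.
move=> Vu dX [dg d2g].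
have dXi i : differentiable (fun w => X w 0 i) u.
  exact: (diff_on_coord (g := X)).
have dgi i : differentiable ('D_(delta_mx 0 i) g) u by exact: d2g.
apply: etrans (derive_eq_on v Vu (fun w Vw => esym (along_coord X dg Vw))) _.
apply: etrans (derive_sum_row v (fun i => differentiable_scale (dXi i) (dgi i))) _.
rewrite (derive_dirE _ (dg _ Vu)) -big_split; apply: eq_bigr => i _ /=.
by apply: etrans (derive_scale v (dXi i) (dgi i)) _; rewrite -derive_row//; exact: dX.
Qed.

(** The second-order terms of the two iterated derivatives are exchanged by [derive_comm_row] and
    cancel; what remains is the derivative along the Lie bracket. *)
Lemma derive_bracket n (X Y : U -> U) (g : U -> 'rV[R]_n.+1) u :
  V u -> diff_on X -> diff_on Y -> diff2_on g ->
  along X (along Y g) u - along Y (along X g) u =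
  'D_(along X Y u - along Y X u) g u.
Proof.
move=> Vu dX dY d2; have [dg d2g] := d2.
have dgi v : differentiable ('D_v g) u by exact: d2g.
rewrite derive_dirB; last exact: dg.
apply: etrans (congr2 (fun a b => a - b) (derive_along (X u) Vu dY d2)
  (derive_along (Y u) Vu dX d2)) _.
rewrite opprD addrACA -[RHS]addr0; congr (_ + _); apply/eqP; rewrite subr_eq0; apply/eqP.
have E (A B : U) : \sum_i A 0 i *: 'D_B ('D_(delta_mx 0 i) g) u =
   \sum_i \sum_j (A 0 i * B 0 j) *: 'D_(delta_mx 0 j) ('D_(delta_mx 0 i) g) u.
  apply: eq_bigr => i _; rewrite [in LHS](derive_dirE _ (dgi _)) scaler_sumr.
  by apply: eq_bigr => j _; rewrite scalerA.
apply: etrans (E (Y u) (X u)) _; apply: esym; apply: etrans (E (X u) (Y u)) _.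
rewrite exchange_big; apply: eq_bigr => i _; apply: eq_bigr => j _.
apply: congr2; first exact: mulrC.
apply: derive_comm_row; [exact: near_open|exact: dgi|exact: dgi].
Qed.

End OpenSet.

(** * Symmetric trace-free tensors on R^3 *)

Section HarmonicTensors.
Variable R : realFieldType.
Notation I3 := 'I_3.

Definition i0 : I3 := @Ordinal 3 0 isT.
Definition i1 : I3 := @Ordinal 3 1 isT.
Definition i2 : I3 := @Ordinal 3 2 isT.

Lemma sum3E (V : nmodType) (F : I3 -> V) : \sum_k F k = F i0 + F i1 + F i2.
Proof.
rewrite !big_ord_recl big_ord0 addr0 addrA.
by congr (_ + _ + _); congr F; apply: val_inj.
Qed.

Lemma ord3_ind (P : I3 -> Prop) : P i0 -> P i1 -> P i2 -> forall i, P i.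
Proof.
move=> p0 p1 p2 [[|[|[|//]]] hi].
- by rewrite (_ : Ordinal hi = i0)//; apply: val_inj.
- by rewrite (_ : Ordinal hi = i1)//; apply: val_inj.
- by rewrite (_ : Ordinal hi = i2)//; apply: val_inj.
Qed.

(* [lookup s n1 n2] is the component of a symmetric tensor with [n1] indices
   equal to 1 and [n2] indices equal to 2. *)
Definition lookup (s : seq (seq R)) (js : seq nat) : R :=
  nth 0 (nth [::] s (count_mem 1%N js)) (count_mem 2%N js).

(** Coordinates on the 7-dimensional space of symmetric trace-free 3-tensors: the components with at
    most one index 2 are free, the others follow from the traces. [harmonic4] treats the
    9-dimensional space of 4-tensors likewise. *)
Definition harmonic3 (a b c d e f g : R) (i j k : I3) : R :=
  lookup [:: [:: a; c; - a - d; - c - g]; [:: b; e; - b - f]; [:: d; g]; [:: f]]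
    [:: nat_of_ord i; nat_of_ord j; nat_of_ord k].

Definition harmonic4 (t1 t2 t3 t4 t5 t6 t7 t8 t9 : R) (l i j k : I3) : R :=
  lookup
    [:: [:: t1; t3; - t1 - t4; - t3 - t7; t1 + t4 + (t4 + t8)];
        [:: t2; t5; - t2 - t6; - t5 - t9];
        [:: t4; t7; - t4 - t8]; [:: t6; t9]; [:: t8]]
    [:: nat_of_ord l; nat_of_ord i; nat_of_ord j; nat_of_ord k].

(** The Levi-Civita symbol as a Vandermonde product, with value 2 / 2 at (0, 1, 2). *)
Definition eps (i j k : I3) : R :=
  ((j : nat)%:R - (i : nat)%:R) * ((k : nat)%:R - (j : nat)%:R)
  * ((k : nat)%:R - (i : nat)%:R) / 2.

Lemma harmonic3E (h : I3 -> I3 -> I3 -> R) :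
  (forall i j k, h i j k = h j i k) -> (forall i j k, h i j k = h i k j) ->
  (forall i, \sum_k h i k k = 0) ->
  h = harmonic3 (h i0 i0 i0) (h i0 i0 i1) (h i0 i0 i2) (h i0 i1 i1)
        (h i0 i1 i2) (h i1 i1 i1) (h i1 i1 i2).
Proof.
move=> S12 S23 tr.
have S12r := (S12 i1 i0, S12 i2 i0, S12 i2 i1).
have S23r i := (S23 i i1 i0, S23 i i2 i0, S23 i i2 i1).
have trE i : h i i2 i2 = - h i i0 i0 - h i i1 i1.
  have := tr i; rewrite sum3E.
  by move: (h i i0 i0) (h i i1 i1) (h i i2 i2) => x y z ?; lra.
apply/funext => i; apply/funext => j; apply/funext => k; move: i j k.
by do 3![apply: ord3_ind]; rewrite /harmonic3 /lookup /= ?(S12r, S23r) ?trE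
  ?(S12r, S23r) //.
Qed.

Lemma harmonic4E (T : I3 -> I3 -> I3 -> I3 -> R) :
  (forall l i j k, T l i j k = T i l j k) -> (forall l i j k, T l i j k = T l j i k) ->
  (forall l i j k, T l i j k = T l i k j) ->
  (forall l i, \sum_k T l i k k = 0) ->
  T = harmonic4 (T i0 i0 i0 i0) (T i0 i0 i0 i1) (T i0 i0 i0 i2) (T i0 i0 i1 i1)
        (T i0 i0 i1 i2) (T i0 i1 i1 i1) (T i0 i1 i1 i2) (T i1 i1 i1 i1)
        (T i1 i1 i1 i2).
Proof.
move=> S12 S23 S34 tr.
have S12r := (S12 i1 i0, S12 i2 i0, S12 i2 i1).
have S23r i := (S23 i i1 i0, S23 i i2 i0, S23 i i2 i1).
have S34r i j := (S34 i j i1 i0, S34 i j i2 i0, S34 i j i2 i1).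
have trE i j : T i j i2 i2 = - T i j i0 i0 - T i j i1 i1.
  have := tr i j; rewrite sum3E.
  by move: (T i j i0 i0) (T i j i1 i1) (T i j i2 i2) => x y z ?; lra.
apply/funext => l; apply/funext => i; apply/funext => j; apply/funext => k.
move: l i j k.
by do 4![apply: ord3_ind]; rewrite /harmonic4 /lookup /=;
  rewrite ?(S12r, S23r, S34r) ?trE ?(S12r, S23r, S34r) ?trE ?(S12r, S23r, S34r) //;
  ring.
Qed.

Lemma epsE (w : I3 -> I3 -> I3 -> R) :
  (forall i j k, w i j k = - w j i k) -> (forall i j k, w i j k = - w i k j) ->
  w i0 i1 i2 = 1 -> w = eps.
Proof.
move=> A12 A23 w1.
have z1 i j : w i i j = 0 by have := A12 i i j => ?; lra.
have z2 i j : w i j j = 0 by have := A23 i j j => ?; lra.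
have z3 i j : w i j i = 0 by rewrite A12 z2 oppr0.
apply/funext => i; apply/funext => j; apply/funext => k; move: i j k.
have w021 : w i0 i2 i1 = -1 by rewrite A23 w1.
have w102 : w i1 i0 i2 = -1 by rewrite A12 w1.
have w120 : w i1 i2 i0 = 1 by rewrite A23 w102 opprK.
have w201 : w i2 i0 i1 = 1 by rewrite A12 w021 opprK.
have w210 : w i2 i1 i0 = -1 by rewrite A12 w120.
by do 3![apply: ord3_ind]; rewrite /eps /= ?(w1, w021, w102, w120, w201, w210, z1, z2, z3);
  field.
Qed.

(** * The Cauchy-Schwarz inequality for 4-tensors *)

Lemma cauchy_schwarz_sum (J : finType) (x y : J -> R) :
  (\sum_j x j * y j) ^+ 2 <= (\sum_j x j ^+ 2) * \sum_j y j ^+ 2.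
Proof.
set b := \sum_j _; set a := \sum_j x j ^+ 2; set c := \sum_j _.
have a0 : 0 <= a by apply: sumr_ge0 => j _; exact: sqr_ge0.
have H : 0 <= a * (a * c - b ^+ 2).
  have -> : a * (a * c - b ^+ 2) = \sum_j (a * y j - b * x j) ^+ 2.
    rewrite (eq_bigr (fun j => a ^+ 2 * y j ^+ 2 - 2 * a * b * (x j * y j)
      + b ^+ 2 * x j ^+ 2)); last by move=> j _; ring.
    rewrite big_split sumrB /= -!mulr_sumr -/a -/b -/c; ring.
  by apply: sumr_ge0 => j _; exact: sqr_ge0.
have [a_eq|a_neq] := eqVneq a 0.
  have x0 j : x j = 0.
    apply/eqP; rewrite -sqrf_eq0; apply/eqP.
    by apply: (psumr_eq0P (P := predT) _ a_eq) => // k _; exact: sqr_ge0.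
  have b0 : b = 0 by rewrite /b big1// => j _; rewrite x0 mul0r.
  by rewrite b0 a_eq expr0n mul0r.
by rewrite -subr_ge0; move: H; rewrite pmulr_rge0// lt_def a_neq.
Qed.

Definition inner4 (A B : I3 -> I3 -> I3 -> I3 -> R) :=
  \sum_l \sum_i \sum_j \sum_k A l i j k * B l i j k.

Lemma inner4_pair A B : inner4 A B =
  \sum_(t : I3 * I3 * I3 * I3) A t.1.1.1 t.1.1.2 t.1.2 t.2 * B t.1.1.1 t.1.1.2 t.1.2 t.2.
Proof. by rewrite /inner4 pair_bigA /= pair_bigA /= pair_bigA. Qed.

Lemma cauchy_schwarz4 A B : inner4 A B ^+ 2 <= inner4 A A * inner4 B B.
Proof. by rewrite !inner4_pair; exact: cauchy_schwarz_sum. Qed.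

(** The weights 1, 4, 6 and 12 count the arrangements of a multiset of four indices. *)
Lemma inner4_harmonic s1 s2 s3 s4 s5 s6 s7 s8 s9 t1 t2 t3 t4 t5 t6 t7 t8 t9 :
  inner4 (harmonic4 s1 s2 s3 s4 s5 s6 s7 s8 s9)
    (harmonic4 t1 t2 t3 t4 t5 t6 t7 t8 t9) =
  s1 * t1 + s8 * t8 + 4 * (s2 * t2 + s3 * t3 + s6 * t6 + s9 * t9)
  + 6 * (s4 * t4) + 12 * (s5 * t5 + s7 * t7)
  + 6 * ((s1 + s4) * (t1 + t4) + (s4 + s8) * (t4 + t8))
  + 12 * ((s2 + s6) * (t2 + t6)) + 4 * ((s3 + s7) * (t3 + t7))
  + 4 * ((s5 + s9) * (t5 + t9)) + (s1 + 2 * s4 + s8) * (t1 + 2 * t4 + t8).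
Proof. rewrite /inner4 !sum3E /harmonic4 /lookup /=; ring. Qed.

(** * The bilinear map (h, T) -> A and its adjoint *)

Definition sym2 (x y z p q r : R) (i j : I3) : R :=
  nth 0 (nth [::] [:: [:: x; y; z]; [:: y; p; q]; [:: z; q; r]] i) j.

Definition contract (h : I3 -> I3 -> I3 -> R) (T : I3 -> I3 -> I3 -> I3 -> R)
  (i j k : I3) := \sum_a \sum_b h a b i * T a b j k.

Definition curl (P : I3 -> I3 -> I3 -> R) (i j : I3) :=
  \sum_a \sum_b eps i a b * P a b j.

Lemma curlE P j : ((curl P i0 j = P i1 i2 j - P i2 i1 j) *
  (curl P i1 j = P i2 i0 j - P i0 i2 j) * (curl P i2 j = P i0 i1 j - P i1 i0 j))%type.
Proof. by rewrite /curl !sum3E /eps /=; do !split; field. Qed.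

Definition sym_curl (P : I3 -> I3 -> I3 -> R) (i j : I3) :=
  2^-1 * (curl P i j + curl P j i).

Definition inner2 (A B : I3 -> I3 -> R) := \sum_i \sum_j A i j * B i j.

(* 28 times the trace-free symmetric part in (c, d, b, j) of
   sum_(i, a) eps_iab B_ij h_cda. *)
Definition dual_harmonic (a b c d e f g x y z p q r : R) := harmonic4
    (8 * a * q - 20 * b * z + 20 * c * y + 16 * d * q - 8 * e * p + 8 *
      e * r)
    (3 * a * z - 7 * b * q + 7 * c * p - 2 * c * r - 5 * c * x - 14 * d
      * z + 14 * e * y + 4 * f * q - 2 * g * p + 2 * g * r)
    (- (17 * a * y) + 4 * b * p - 9 * b * r + 5 * b * x + 11 * c * q -
      14 * d * y - 14 * e * z + 2 * f * p - 2 * f * r + 4 * g * q)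
    (6 * a * q + 8 * b * z - 6 * c * y - 8 * d * q + 8 * e * p - 8 * e *
      x - 6 * f * z + 6 * g * y)
    (- (7 * a * p) + 3 * a * r + 4 * a * x - 7 * b * y + c * z - 4 * d *
      p - 4 * d * r + 8 * d * x - 6 * f * y - 6 * g * z)
    (- (4 * a * z) + 14 * b * q - 2 * c * r + 2 * c * x + 7 * d * z - 14
      * e * y - 3 * f * q + 5 * g * p + 2 * g * r - 7 * g * x)
    (6 * a * y - 8 * b * p + 4 * b * r + 4 * b * x + 6 * c * q + 7 * d *
      y - 4 * f * p - 3 * f * r + 7 * f * x - g * q)
    (- (16 * b * z) + 20 * d * q - 8 * e * r + 8 * e * x - 8 * f * z -
      20 * g * y)
    (2 * a * r - 2 * a * x + 14 * b * y - 4 * c * z - 5 * d * p + 9 * d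
      * r - 4 * d * x + 14 * e * q + 17 * f * y - 11 * g * z).

Section Params.
Variables (a b c d e f g x y z p q r : R).
Variables (t1 t2 t3 t4 t5 t6 t7 t8 t9 : R).
Let h := harmonic3 a b c d e f g.
Let T := harmonic4 t1 t2 t3 t4 t5 t6 t7 t8 t9.
Let B := sym2 x y z p q r.
Let L := dual_harmonic a b c d e f g x y z p q r.

(** For symmetric B, <A, B> is the pairing of T with a 4-tensor bilinear in h and B; as T is
    symmetric and trace-free, it sees only the symmetric trace-free part of that tensor. The factor
    28 clears denominators. *)
Lemma sym_curl_dual : 28 * inner2 (sym_curl (contract h T)) B = inner4 L T.
Proof.
rewrite /L /T inner4_harmonic /inner2 !sum3E /sym_curl !curlE /contract !sum3E.
rewrite /T /h /B /harmonic4 /harmonic3 /sym2 /lookup /=.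
by field.
Qed.

End Params.

(** * Norm identities for the dual tensor *)

Definition gram (h : I3 -> I3 -> I3 -> R) (i j : I3) :=
  \sum_a \sum_b h a b i * h a b j.

Definition mul2 (A B : I3 -> I3 -> R) (i j : I3) := \sum_k A i k * B k j.

Definition tr2 (A : I3 -> I3 -> R) := \sum_i A i i.

(* The three other components of [h (x) B] under SO(3) that enter the norm
   identity below: a vector, a symmetric matrix and a symmetric 3-tensor. *)
Definition vec_part h (B : I3 -> I3 -> R) (i : I3) := \sum_a \sum_b h i a b * B a b.

Definition mx_part (h : I3 -> I3 -> I3 -> R) (B : I3 -> I3 -> R) :=
  sym_curl (fun a b j => \sum_c h a j c * B b c).

Definition cubic_part (h : I3 -> I3 -> I3 -> R) (B : I3 -> I3 -> R) (i j k : I3) :=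
  3^-1 * (\sum_a h i j a * B a k + \sum_a h j k a * B a i + \sum_a h k i a * B a j).

(** Under SO(3), h (x) B has parts of ranks 1 to 5. Invariants quadratic in h and in B span only a
    3-dimensional space, so the squared norms of the parts are linearly dependent, and the rank 5
    part can be eliminated with positive coefficients left on the others. B is made trace-free by
    its last entry, and 784 is the square of 28. *)
Lemma dual_norm a b c d e f g x y z p q :
  let h := harmonic3 a b c d e f g in
  let B := sym2 x y z p q (- x - p) in
  let L := dual_harmonic a b c d e f g x y z p q (- x - p) in
  inner4 L L / 784 + 11 / 42 * inner2 (mx_part h B) (mx_part h B)
  + 4^-1 * (\sum_i \sum_j \sum_k cubic_part h B i j k ^+ 2)
  + 7 / 12 * (\sum_i vec_part h B i ^+ 2) =
  5 / 12 * tr2 (gram h) * inner2 B B.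
Proof.
rewrite /= /dual_harmonic inner4_harmonic /inner2 /tr2 /mx_part /sym_curl /gram.
rewrite !sum3E !curlE /cubic_part /vec_part !sum3E.
rewrite /harmonic3 /sym2 /lookup /=.
by field.
Qed.

(** For B = S the norm of L is itself a polynomial in s, q and r, so nothing has to be discarded as
    in the use of [dual_norm]. *)
Lemma dual_norm_gram a b c d e f g :
  let h := harmonic3 a b c d e f g in
  let S := gram h in
  let L := dual_harmonic a b c d e f g (S i0 i0) (S i0 i1) (S i0 i2) (S i1 i1)
     (S i1 i2) (S i2 i2) in
  12 * inner4 L L = 784 * (- 4 * tr2 S ^+ 3 + 17 * (tr2 S * tr2 (mul2 S S))
    - 15 * tr2 (mul2 (mul2 S S) S)).
Proof.
rewrite /= /dual_harmonic inner4_harmonic /tr2 /mul2 !sum3E /gram !sum3E.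
rewrite /harmonic3 /lookup /=.
by ring.
Qed.

Lemma sym2E (A : I3 -> I3 -> R) : (forall i j, A i j = A j i) ->
  A = sym2 (A i0 i0) (A i0 i1) (A i0 i2) (A i1 i1) (A i1 i2) (A i2 i2).
Proof.
move=> As; apply/funext => i; apply/funext => j; move: i j.
by apply: ord3_ind; apply: ord3_ind; rewrite /sym2 /= ?[A i1 i0]As ?[A i2 i0]As
  ?[A i2 i1]As.
Qed.

Lemma inner2_ge0 (A : I3 -> I3 -> R) : 0 <= inner2 A A.
Proof. by apply: sumr_ge0 => i _; apply: sumr_ge0 => j _; exact: sqr_ge0. Qed.

Lemma inner4_ge0 A : 0 <= inner4 A A.
Proof. by do 4!(apply: sumr_ge0 => ? _); exact: sqr_ge0. Qed.

Lemma sym_curlC P i j : sym_curl P i j = sym_curl P j i.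
Proof. by rewrite /sym_curl addrC. Qed.

(** * The two inequalities for abstract tensors h and T *)

Section Inequalities.
Variables (h : I3 -> I3 -> I3 -> R) (T : I3 -> I3 -> I3 -> I3 -> R).
Hypotheses (h12 : forall i j k, h i j k = h j i k)
  (h23 : forall i j k, h i j k = h i k j) (h_tr : forall i, \sum_k h i k k = 0).
Hypotheses (T12 : forall l i j k, T l i j k = T i l j k)
  (T23 : forall l i j k, T l i j k = T l j i k)
  (T34 : forall l i j k, T l i j k = T l i k j)
  (T_tr : forall l i, \sum_k T l i k k = 0).

Let A := sym_curl (contract h T).
Let S := gram h.

(** P is symmetric in its last two indices because T is, so its full contraction with [eps], the
    trace of A, vanishes. The form is the one that [dual_norm] requires of B. *)
Lemma sym_curl_tr : A i2 i2 = - A i0 i0 - A i1 i1.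
Proof.
rewrite /A (harmonic3E h12 h23 h_tr) (harmonic4E T12 T23 T34 T_tr).
rewrite /sym_curl !curlE /contract !sum3E /harmonic3 /harmonic4 /lookup /=; by field.
Qed.

Lemma inner_dual x y z p q r : 28 * inner2 A (sym2 x y z p q r) =
  inner4 (dual_harmonic (h i0 i0 i0) (h i0 i0 i1) (h i0 i0 i2) (h i0 i1 i1)
    (h i0 i1 i2) (h i1 i1 i1) (h i1 i1 i2) x y z p q r) T.
Proof.
have := sym_curl_dual (h i0 i0 i0) (h i0 i0 i1) (h i0 i0 i2) (h i0 i1 i1)
    (h i0 i1 i2) (h i1 i1 i1) (h i1 i1 i2) x y z p q r
  (T i0 i0 i0 i0) (T i0 i0 i0 i1) (T i0 i0 i0 i2) (T i0 i0 i1 i1) (T i0 i0 i1 i2)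
  (T i0 i1 i1 i1) (T i0 i1 i1 i2) (T i1 i1 i1 i1) (T i1 i1 i1 i2).
by rewrite -(harmonic3E h12 h23 h_tr) -(harmonic4E T12 T23 T34 T_tr).
Qed.

(** With B = A, Cauchy-Schwarz and [dual_norm] bound |A|^4 by |A|^2 times the right-hand side; a
    factor |A|^2 is then cancelled, the case A = 0 being trivial. *)
Lemma sym_curl_norm_le : inner2 A A <= 5 / 12 * tr2 S * inner4 T T.
Proof.
have [L LT LL] : exists2 L, 28 * inner2 A A = inner4 L T &
    inner4 L L <= 784 * (5 / 12 * tr2 S * inner2 A A).
  have hE := harmonic3E h12 h23 h_tr.
  have AE : A = sym2 (A i0 i0) (A i0 i1) (A i0 i2) (A i1 i1) (A i1 i2)
      (- A i0 i0 - A i1 i1).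
    by rewrite -sym_curl_tr; apply: sym2E => i j; exact: sym_curlC.
  have := @dual_norm (h i0 i0 i0) (h i0 i0 i1) (h i0 i0 i2) (h i0 i1 i1)
    (h i0 i1 i2) (h i1 i1 i1) (h i1 i1 i2) (A i0 i0) (A i0 i1) (A i0 i2)
    (A i1 i1) (A i1 i2).
  rewrite -hE -AE /=; set L := dual_harmonic _ _ _ _ _ _ _ _ _ _ _ _ _ => LE.
  exists L; last first.
    have c0 : 0 <= \sum_i \sum_j \sum_k cubic_part h A i j k ^+ 2.
      by do 3!(apply: sumr_ge0 => ? _); exact: sqr_ge0.
    have v0 : 0 <= \sum_i vec_part h A i ^+ 2.
      by apply: sumr_ge0 => i _; exact: sqr_ge0.
    have := inner2_ge0 (mx_part h A); rewrite -/S in LE.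
    move: LE c0 v0; move: (inner4 _ _) (inner2 _ _) (\sum_i _) (\sum_i _) (_ * inner2 A A).
    by move=> *; lra.
  by rewrite {2}AE; exact: inner_dual.
have := cauchy_schwarz4 L T; rewrite -LT => C.
have T0 := inner4_ge0 T; have A0 := inner2_ge0 A.
have {}C : inner2 A A ^+ 2 <= 5 / 12 * tr2 S * inner2 A A * inner4 T T.
  have := ler_wpM2r T0 LL; move: C; rewrite exprMn.
  move: (inner4 L L * _) (inner2 A A ^+ 2) => x y.
  rewrite -[784 * _ * _]mulrA; move: (_ * inner4 T T) => z *; lra.
have [A_eq|A_neq] := eqVneq (inner2 A A) 0.
  rewrite A_eq mulr_ge0// mulr_ge0//; apply: sumr_ge0 => i _.
  by do 2!(apply: sumr_ge0 => ? _); exact: sqr_ge0.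
have A_gt0 : 0 < inner2 A A by rewrite lt_def A_neq.
by rewrite -(ler_pM2l A_gt0) -expr2 (le_trans C)// mulrAC [in leRHS]mulrC.
Qed.

Lemma sym_curl_gram_le : inner2 A S ^+ 2 <=
  1 / 12 * (- 4 * tr2 S ^+ 3 + 17 * (tr2 S * tr2 (mul2 S S))
    - 15 * tr2 (mul2 (mul2 S S) S)) * inner4 T T.
Proof.
have hE := harmonic3E h12 h23 h_tr.
have Ss i j : S i j = S j i.
  by apply: eq_bigr => a _; apply: eq_bigr => b _; rewrite mulrC.
have SE := sym2E Ss.
have := @dual_norm_gram (h i0 i0 i0) (h i0 i0 i1) (h i0 i0 i2) (h i0 i1 i1)
    (h i0 i1 i2) (h i1 i1 i1) (h i1 i1 i2).
rewrite -hE /= -/S; set L := dual_harmonic _ _ _ _ _ _ _ _ _ _ _ _ _ => LE.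
have LT : 28 * inner2 A S = inner4 L T.
  by rewrite {1}SE; exact: inner_dual.
have := cauchy_schwarz4 L T; rewrite -LT exprMn => C.
set Q := _ - 15 * _ in LE *.
have {}LE : 12 * (inner4 L L * inner4 T T) = 784 * (Q * inner4 T T).
  by rewrite !mulrA LE.
move: LE C; rewrite -[1 / 12 * Q * _]mulrA.
by move: (Q * _) (inner4 L L * _) (inner2 A S ^+ 2) => x y z *; lra.
Qed.

End Inequalities.

(** * Symmetry and vanishing traces of T *)

Lemma cubic_exchange (h : I3 -> I3 -> I3 -> R) (l i j m : I3) :
  (forall i j k, h i j k = h j i k) -> (forall i j k, h i j k = h i k j) ->
  (forall i, \sum_k h i k k = 0) ->
  let X j m := \sum_k h i j k * eps l k m - 4^-1 * (\sum_a h i a j * eps l a m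
    + \sum_a h j a l * eps i a m + \sum_a h l a i * eps j a m) in
  X j m = X m j.
Proof.
(* Conceptually: contracted with eps_jmn, the first sum of [X] gives -h_iln and the three correction
   sums give -1, -1 and -2 times h_iln, so that the factor 1/4 removes the part antisymmetric in j
   and m. *)
move=> h12 h23 h_tr /=; rewrite (harmonic3E h12 h23 h_tr) !sum3E; move: l i j m.
by do 4![apply: ord3_ind]; rewrite /harmonic3 /lookup /eps /=; field.
Qed.

Section TTensor.
Variables (h : I3 -> I3 -> I3 -> R) (D n : I3 -> I3 -> I3 -> I3 -> R)
  (g : I3 -> I3 -> I3 -> R).
Hypotheses (h12 : forall i j k, h i j k = h j i k)
  (h23 : forall i j k, h i j k = h i k j) (h_tr : forall i, \sum_k h i k k = 0).
Hypotheses (D23 : forall l i j k, D l i j k = D l j i k)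
  (D34 : forall l i j k, D l i j k = D l i k j)
  (D_tr : forall l i, \sum_k D l i k k = 0).
Hypothesis g_anti : forall l i k, g l i k = - g l k i.
Hypothesis nE : forall l i j m, n l i j m = D l i j m
  + \sum_k h i j k * (eps l k m + g l k m)
  - \sum_k g l i k * h k j m - \sum_k g l j k * h i k m.
Hypothesis n12 : forall l i j m, n l i j m = n i l j m.

(** In this section [D] stands for the frame derivatives of the components of h, [g] for the
    connection coefficients and [n] for the covariant derivative of h; [n12] is the Codazzi
    equation. *)
Definition ttensor l i j m := n l i j m - 4^-1 * (\sum_a h i a j * eps l a m
  + \sum_a h j a l * eps i a m + \sum_a h l a i * eps j a m).

Lemma h13 i j k : h i j k = h k j i.
Proof. by rewrite h12 h23 h12. Qed.

(** As h is symmetric, a transposition of l, i, j merely permutes the three correction sums, so only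
    the Codazzi equation for [n] is at stake. *)
Lemma ttensor12 l i j m : ttensor l i j m = ttensor i l j m.
Proof.
rewrite /ttensor n12; congr (_ - _ * _).
have E1 : \sum_a h i a j * eps l a m = \sum_a h j a i * eps l a m.
  by apply: eq_bigr => a _; rewrite (h13 i a j).
have E2 : \sum_a h j a l * eps i a m = \sum_a h l a j * eps i a m.
  by apply: eq_bigr => a _; rewrite (h13 j a l).
have E3 : \sum_a h l a i * eps j a m = \sum_a h i a l * eps j a m.
  by apply: eq_bigr => a _; rewrite (h13 l a i).
by rewrite E1 E2 E3; congr (_ + _); exact: addrC.
Qed.

Lemma n23 l i j m : n l i j m = n l j i m.
Proof.
rewrite !nE D23 -!addrA; congr (_ + (_ + _)).
  by apply: eq_bigr => k _; rewrite h12.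
rewrite addrC; congr (- _ - _); apply: eq_bigr => k _.
  by rewrite h12.
by rewrite h12.
Qed.

Lemma ttensor23 l i j m : ttensor l i j m = ttensor l j i m.
Proof.
rewrite /ttensor n23; congr (_ - _ * _).
rewrite addrAC; congr (_ + _ + _); apply: eq_bigr => a _.
- by rewrite (h13 i a j).
- by rewrite (h13 l a i).
- by rewrite (h13 j a l).
Qed.

(** By antisymmetry of [g], the connection term of the last slot has the same form as those of the
    other two, and the connection part is symmetric in j and m. The [eps] terms are left to
    [cubic_exchange]. *)
Lemma ttensor34 l i j m : ttensor l i j m = ttensor l i m j.
Proof.
have gE j' m' : \sum_k h i j' k * (eps l k m' + g l k m') =
    \sum_k h i j' k * eps l k m' - \sum_k g l m' k * h i k j'.
  rewrite -sumrB; apply: eq_bigr => k _.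
  by rewrite (h23 i k j') (g_anti l m' k) mulrDr mulNr opprK [g _ _ _ * _]mulrC.
have E k j' m' : g l i k * h k j' m' = g l i k * h k m' j' by rewrite h23.
have := cubic_exchange l i j m h12 h23 h_tr => /=.
rewrite /ttensor !nE !gE D34 (eq_bigr _ (fun k _ => E k j m)).
move=> H; apply/eqP; rewrite -subr_eq0; apply/eqP; move/eqP: H; rewrite -subr_eq0 => /eqP H.
rewrite -[RHS]H; ring.
Qed.

Lemma sym_anti_sum (s a : I3 -> I3 -> R) : (forall i j, s i j = s j i) ->
  (forall i j, a i j = - a j i) -> \sum_i \sum_j s i j * a i j = 0.
Proof.
move=> ss aa; have : \sum_i \sum_j s i j * a i j = - \sum_i \sum_j s i j * a i j.
  rewrite {1}exchange_big -sumrN; apply: eq_bigr => i _.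
  by rewrite -sumrN; apply: eq_bigr => j _; rewrite ss aa mulrN.
by move: (\sum_i _) => x ?; lra.
Qed.

Lemma eps_anti12 i j k : eps i j k = - eps j i k.
Proof. by rewrite /eps; field. Qed.

Lemma h_tr12 m : \sum_i h i i m = 0.
Proof. by rewrite -[RHS](h_tr m); apply: eq_bigr => i _; exact: h13. Qed.

(** With the trace moved to the two middle slots, each sum either contains a trace of h or of D, or
    pairs a symmetric with an antisymmetric array. *)
Lemma ttensor_tr l i : \sum_k ttensor l i k k = 0.
Proof.
rewrite (eq_bigr (fun k => ttensor l k k i)); last first.
  by move=> k _; rewrite ttensor23 ttensor34.
rewrite sumrB -mulr_sumr !big_split /=.
have -> : \sum_k n l k k i = 0.
  rewrite (eq_bigr _ (fun k _ => nE l k k i)) !sumrB big_split /=.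
  have -> : \sum_k D l k k i = 0.
    by rewrite -[RHS](D_tr l i); apply: eq_bigr => k _; rewrite D34 D23.
  have -> : \sum_k \sum_a h k k a * (eps l a i + g l a i) = 0.
    rewrite exchange_big big1// => a _.
    by rewrite -mulr_suml h_tr12 mul0r.
  have -> : \sum_k \sum_a g l k a * h a k i = 0.
    rewrite -[RHS](@sym_anti_sum (fun k a => h a k i) (g l)).
    - by apply: eq_bigr => k _; apply: eq_bigr => a _; rewrite mulrC.
    - by move=> *; rewrite h12.
    - exact: g_anti.
  have -> : \sum_k \sum_a g l k a * h k a i = 0.
    rewrite -[RHS](@sym_anti_sum (fun k a => h k a i) (g l)).
    - by apply: eq_bigr => k _; apply: eq_bigr => a _; rewrite mulrC.
    - by move=> *; rewrite h12.
    - exact: g_anti.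
  by rewrite !addr0 !subr0.
have -> : \sum_k \sum_a h k a k * eps l a i = 0.
  rewrite exchange_big big1// => a _.
  rewrite -mulr_suml (_ : \sum_k h k a k = 0) ?mul0r//.
  by rewrite -[RHS](h_tr a); apply: eq_bigr => k _; rewrite h12.
rewrite (@sym_anti_sum (fun k a => h k a l) (fun k a => eps k a i)).
- rewrite (@sym_anti_sum (fun k a => h l a k) (fun k a => eps k a i)).
  + by rewrite !addr0 mulr0 subr0.
  + by move=> *; rewrite h23.
  + by move=> *; exact: eps_anti12.
- by move=> *; rewrite h12.
- by move=> *; exact: eps_anti12.
Qed.

End TTensor.

End HarmonicTensors.

(* Derivatives, cross products and frame components are sealed with this key:
   unification would otherwise unfold them down to limits and matrix entries. *)
Fact frame_key : unit. Proof. exact: tt. Qed.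

Section SealedCross.
Variable R : realType.
Implicit Types u v w : 'rV[R]_7.

Definition cr u v : 'rV[R]_7 := locked_with frame_key (@cross R) u v.

Lemma crE : cr = @cross R.
Proof. by apply/funext => u; apply/funext => v; rewrite /cr unlock. Qed.

Lemma crC u v : cr u v = - cr v u.
Proof. by rewrite crE crossC. Qed.

Lemma crZr k u w : cr w (k *: u) = k *: cr w u.
Proof. by rewrite crE crossZr. Qed.

Lemma cr_sumr m (F : 'I_m -> 'rV[R]_7) w :
  cr w (\sum_i F i) = \sum_i cr w (F i).
Proof. by rewrite crE cross_sumr. Qed.

Lemma dot_crC u v w : dot (cr u v) w = dot (cr v w) u.
Proof. by rewrite crE dot_crossC. Qed.

Lemma dot_cr_swap u v w : dot (cr u v) w = - dot (cr u w) v.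
Proof.
rewrite dot_crC crC dotNl dot_crC crC dotNl -dot_crC crC dotNl opprK.
by rewrite dot_crC.
Qed.

Lemma dot_cr_cr x y a b :
  dot (cr x a) (cr y b) + dot (cr y a) (cr x b) =
  2 * dot x y * dot a b - dot x a * dot y b - dot y a * dot x b.
Proof. by rewrite crE dot_cross_cross. Qed.

End SealedCross.

(** * Moving frames of Lagrangian immersions *)

Section MovingFrame.
Variable R : realType.
Notation U := 'rV[R]_3.
Variables (V : set U) (f : U -> 'rV[R]_7) (e : frame R).
Hypotheses (hV : open V) (fS : smooth_on V f).
Hypothesis f_unit : forall u, V u -> dot (f u) (f u) = 1.
Hypothesis f_lag : forall u, V u -> lagrangian_at f u.
Hypothesis he : oriented_orthonormal_frame f V e.

Definition dd n (g : U -> 'rV[R]_n.+1) (x : U) : U -> 'rV[R]_n.+1 :=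
  locked_with frame_key ('D_x g).

Definition DD (i : 'I_3) n (g : U -> 'rV[R]_n.+1) : U -> 'rV[R]_n.+1 :=
  locked_with frame_key (along (e i) g).

Definition E : 'I_3 -> U -> 'rV[R]_7 :=
  locked_with frame_key (fun i => along (e i) f).
Definition N : 'I_3 -> U -> 'rV[R]_7 :=
  locked_with frame_key (fun i u => cr (f u) (E i u)).

Lemma ddE n (g : U -> 'rV[R]_n.+1) x u : dd g x u = 'D_x g u.
Proof. by rewrite /dd unlock. Qed.

Lemma DDE i n (g : U -> 'rV[R]_n.+1) : DD i g = along (e i) g.
Proof. by rewrite /DD unlock. Qed.

Lemma DDdd i n (g : U -> 'rV[R]_n.+1) u : DD i g u = dd g (e i u) u.
Proof. by rewrite DDE ddE. Qed.

Lemma EE i : E i = along (e i) f.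
Proof. by rewrite /E unlock. Qed.

Lemma Edd i u : E i u = dd f (e i u) u.
Proof. by rewrite EE ddE. Qed.

Lemma NE i u : N i u = cr (f u) (E i u).
Proof. by rewrite /N unlock. Qed.

Lemma diff2_f : diff2_on V f.
Proof.
by split=> [u Vu|v u Vu]; [exact: (fS [::])|exact: (fS [:: v])].
Qed.

Lemma diff_f : diff_on V f. Proof. exact: diff2_f.1. Qed.

Lemma diff2_df v : diff2_on V ('D_v f).
Proof.
by split=> [u Vu|w u Vu]; [exact: (fS [:: v])|exact: (fS [:: w; v])].
Qed.

Lemma diff2_e i : diff2_on V (e i).
Proof.
have [eS _ _] := he.
by split=> [u Vu|v u Vu]; [exact: (eS i [::])|exact: (eS i [:: v])].
Qed.

Lemma diff_e i : diff_on V (e i). Proof. exact: (diff2_e i).1. Qed.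

Lemma diff_E i : diff_on V (E i).
Proof. rewrite EE; exact (diff_along hV (diff_e i) diff2_f). Qed.

(** Since E_i contains a first derivative of f, this uses differentiability of the second
    derivatives of f; it makes the commutation of derivatives available for E_i. *)
Lemma diff2_E i : diff2_on V (E i).
Proof.
split=> [|v]; first exact: diff_E.
rewrite EE.
have Ev : eq_on V (fun w => along ('D_v (e i)) f w
    + \sum_k e i w 0 k *: 'D_v ('D_(delta_mx 0 k) f) w) ('D_v (along (e i) f)).
  by move=> u Vu; exact (esym (derive_along hV v Vu (diff_e i) diff2_f)).
apply: (diff_on_eq hV Ev) => u Vu; apply: differentiableD.
  exact (diff_along hV ((diff2_e i).2 v) diff2_f Vu).
apply: (@diff_on_sum R 2 V) Vu => k w Vw; apply: differentiable_scale.
  exact (diff_on_coord k (diff_e i) Vw).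
exact ((diff2_df _).2 _ _ Vw).
Qed.

(** * The orthonormal basis f, E_i, N_i of R^7 *)

Lemma dot_EE i j u : V u -> dot (E i u) (E j u) = (i == j)%:R.
Proof. have [_ h _] := he => Vu; rewrite !EE; exact: h. Qed.

Lemma dd0 n (g : U -> 'rV[R]_n.+1) u : dd g 0 u = 0.
Proof. by rewrite ddE derive0. Qed.

Lemma dd_sum n (g : U -> 'rV[R]_n.+1) u l (k : 'I_l -> R) (v : 'I_l -> U) :
  differentiable g u -> dd g (\sum_i k i *: v i) u = \sum_i k i *: dd g (v i) u.
Proof.
move=> dg; rewrite ddE; apply: etrans (derive_dir_sum k v dg) _.
by apply: eq_bigr => i _; rewrite ddE.
Qed.

(** The coordinates of a combination of the e_k are recovered in R^7 as inner products with the
    orthonormal E_k; hence the frame matrix [P] has trivial kernel and is invertible. *)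
Lemma frame_expand u (x : U) : V u ->
  x = \sum_k dot (dd f x u) (E k u) *: e k u.
Proof.
move=> Vu; have df := diff_f Vu.
pose P : 'M[R]_3 := \matrix_(i, m) e i u 0 m.
have PE (y : U) : y *m P = \sum_k y 0 k *: e k u.
  by apply/rowP => m; rewrite mxE summxE; apply: eq_bigr => k _; rewrite !mxE.
have EP (y : U) j : dot (dd f (y *m P) u) (E j u) = y 0 j.
  rewrite PE dd_sum// dot_suml (bigD1 j)//= big1 => [|k kj].
    by rewrite dotZl -Edd dot_EE// eqxx mulr1 addr0.
  by rewrite dotZl -Edd dot_EE// (negPf kj) mulr0.
have injP (y : U) : y *m P = 0 -> y = 0.
  by move=> yP; apply/rowP => j; rewrite -EP yP mxE dd0; exact: dot0l.
have uP : P \in unitmx.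
  rewrite -row_free_unit -kermx_eq0; apply/eqP/row_matrixP => i.
  by rewrite row0; apply: injP; rewrite -row_mul mulmx_ker row0.
have -> : x = (x *m invmx P) *m P by rewrite mulmxKV.
by rewrite [LHS]PE; apply: eq_bigr => k _; rewrite EP.
Qed.

Lemma push_expand u (x : U) : V u ->
  dd f x u = \sum_k dot (dd f x u) (E k u) *: E k u.
Proof.
move=> Vu; rewrite {1}(frame_expand x Vu) dd_sum; last exact: diff_f.
by apply: eq_bigr => k _; rewrite Edd.
Qed.

Lemma dot_const (g h : U -> 'rV[R]_7) c u v : V u ->
  diff_on V g -> diff_on V h -> (forall w, V w -> dot (g w) (h w) = c) ->
  dot (dd g v u) (h u) = - dot (g u) (dd h v u).
Proof.
move=> Vu dg dh ghc; apply/eqP; rewrite -addr_eq0 !ddE; apply/eqP.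
apply: etrans (esym (derive_dot v (dg _ Vu) (dh _ Vu))) _.
exact (derive_cst_on hV v Vu ghc).
Qed.

Lemma dot_f_df u v : V u -> dot (dd f v u) (f u) = 0.
Proof.
move=> Vu; have := dot_const v Vu diff_f diff_f f_unit.
by rewrite [dot (f u) _]dotC; move: (dot _ _) => x ?; lra.
Qed.

Lemma dot_Ef i u : V u -> dot (E i u) (f u) = 0.
Proof. rewrite Edd; exact: dot_f_df. Qed.

Lemma N_lag i u : V u ->
  dot (N i u) (f u) = 0 /\ forall b, dot (N i u) ('D_b f u) = 0.
Proof.
move=> Vu; apply/(f_lag Vu); exists (e i u).
by rewrite NE crE EE.
Qed.

Lemma dot_N_df i u v : V u -> dot (dd f v u) (N i u) = 0.
Proof. by move=> Vu; rewrite dotC ddE; exact: (N_lag i Vu).2. Qed.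

Lemma dot_EN i j u : V u -> dot (E i u) (N j u) = 0.
Proof. rewrite Edd; exact: dot_N_df. Qed.

Lemma dot_fN i u : V u -> dot (f u) (N i u) = 0.
Proof. by move=> Vu; rewrite dotC; exact: (N_lag i Vu).1. Qed.

Lemma dot_NN i j u : V u -> dot (N i u) (N j u) = (i == j)%:R.
Proof.
move=> Vu; have := dot_cr_cr (f u) (f u) (E i u) (E j u).
rewrite f_unit// dot_EE// ![dot (f u) _]dotC !dot_Ef// -!NE.
by move: (dot _ _) => x; rewrite mulr1 !mul0r !subr0 => ?; lra.
Qed.

(** The Lagrangian condition makes v the image under J of a tangent vector, and J carries the E_k to
    the N_k. *)
Lemma normal_expand u v : V u -> dot v (f u) = 0 ->
  (forall j, dot v (E j u) = 0) -> v = \sum_k dot v (N k u) *: N k u.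
Proof.
move=> Vu vf vE.
have [|a va] := (f_lag Vu v).2.
  split=> // b; rewrite -ddE (push_expand b Vu) dot_sumr big1// => k _.
  by rewrite dotZr vE mulr0.
have vN : v = \sum_k dot (dd f a u) (E k u) *: N k u.
  rewrite va -ddE -crE {1}(push_expand a Vu) cr_sumr; apply: eq_bigr => k _.
  by rewrite crZr NE.
rewrite {1}vN; apply: eq_bigr => k _; congr (_ *: _).
rewrite vN dot_suml (bigD1 k)//= big1 => [|j jk].
  by rewrite dotZl dot_NN// eqxx mulr1 addr0.
by rewrite dotZl dot_NN// (negPf jk) mulr0.
Qed.

Lemma parseval u v w : V u -> dot v w = dot v (f u) * dot w (f u)
  + \sum_k dot v (E k u) * dot w (E k u) + \sum_k dot v (N k u) * dot w (N k u).
Proof.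
move=> Vu.
pose v' := v - dot v (f u) *: f u - \sum_k dot v (E k u) *: E k u.
have v'E j : dot v' (E j u) = 0.
  rewrite /v' !dotBl dotZl [dot (f u) _]dotC dot_Ef// mulr0 subr0 dot_suml.
  rewrite (bigD1 j)//= big1 => [|k kj].
    by rewrite dotZl dot_EE// eqxx mulr1 addr0 subrr.
  by rewrite dotZl dot_EE// (negPf kj) mulr0.
have v'f : dot v' (f u) = 0.
  rewrite /v' !dotBl dotZl f_unit// mulr1 subrr dot_suml big1 ?subr0// => k _.
  by rewrite dotZl dot_Ef// mulr0.
have v'N j : dot v' (N j u) = dot v (N j u).
  rewrite /v' !dotBl dotZl dot_fN// mulr0 subr0 dot_suml big1 ?subr0// => k _.
  by rewrite dotZl dot_EN// mulr0.
have vE : v = dot v (f u) *: f u + \sum_k dot v (E k u) *: E k u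
    + \sum_k dot v (N k u) *: N k u.
  under [X in _ + X]eq_bigr => k _ do rewrite -v'N.
  by rewrite -normal_expand// addrC /v' -[X in X + _]addrA -opprD subrK.
rewrite {1}vE !dotDl dotZl !dot_suml [dot (f u) w]dotC.
by congr (_ + _ + _); apply: eq_bigr => k _; rewrite dotZl [dot (_ k u) w]dotC.
Qed.

(* The components <nabla_(e_i) e_j, e_k>, h_ijk, <E_i x E_j, E_k> and omega_ijk. *)
Definition gam : 'I_3 -> 'I_3 -> 'I_3 -> U -> R := locked_with frame_key
  (fun i j k u => dot (DD i (E j) u) (E k u)).
Definition hh : 'I_3 -> 'I_3 -> 'I_3 -> U -> R := locked_with frame_key
  (fun i j k u => dot (DD i (E j) u) (N k u)).
Definition phi : 'I_3 -> 'I_3 -> 'I_3 -> U -> R := locked_with frame_key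
  (fun i j k u => dot (cr (E i u) (E j u)) (E k u)).
Definition om : 'I_3 -> 'I_3 -> 'I_3 -> U -> R := locked_with frame_key
  (fun i j k u => dot (cr (E i u) (E j u)) (N k u)).

Lemma gamE i j k u : gam i j k u = dot (DD i (E j) u) (E k u).
Proof. by rewrite /gam unlock. Qed.

Lemma hhE i j k u : hh i j k u = dot (DD i (E j) u) (N k u).
Proof. by rewrite /hh unlock. Qed.

Lemma phiE i j k u : phi i j k u = dot (cr (E i u) (E j u)) (E k u).
Proof. by rewrite /phi unlock. Qed.

Lemma omE i j k u : om i j k u = dot (cr (E i u) (E j u)) (N k u).
Proof. by rewrite /om unlock. Qed.

Lemma hh_fun i j k : hh i j k = fun u => dot (DD i (E j) u) (N k u).
Proof. by rewrite /hh unlock. Qed.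

Lemma diff_N i : diff_on V (N i).
Proof.
rewrite /N unlock crE => u Vu.
by apply: differentiable_cross; [exact: diff_f|exact: diff_E].
Qed.

Lemma diff_DE i j : diff_on V (DD i (E j)).
Proof. rewrite DDE; exact (diff_along hV (diff_e i) (diff2_E j)). Qed.

Lemma diff_gam i j k : diff_on V (gam i j k).
Proof.
rewrite (_ : gam i j k = fun u => dot (DD i (E j) u) (E k u)); last first.
  by apply/funext => u; rewrite gamE.
by move=> u Vu; apply: differentiable_dot; [exact: diff_DE|exact: diff_E].
Qed.

Lemma diff_hh i j k : diff_on V (hh i j k).
Proof.
rewrite hh_fun => u Vu.
by apply: differentiable_dot; [exact: diff_DE|exact: diff_N].
Qed.

(** * Structure equations: symmetry of h and the products E_i × E_j *)

Lemma gam_anti i j k u : V u -> gam i j k u = - gam i k j u.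
Proof.
move=> Vu; rewrite gamE DDdd.
have H := dot_const (e i u) Vu (diff_E j) (diff_E k) (@dot_EE j k).
by rewrite H -DDdd dotC gamE.
Qed.

Lemma bracket_f i j u : V u -> DD i (E j) u - DD j (E i) u =
  dd f (DD i (e j) u - DD j (e i) u) u.
Proof.
move=> Vu; rewrite ddE !DDE !EE; exact (derive_bracket hV Vu (diff_e i) (diff_e j) diff2_f).
Qed.

Lemma bracket_expand i j u : V u -> DD i (e j) u - DD j (e i) u =
  \sum_k (gam i j k u - gam j i k u) *: e k u.
Proof.
move=> Vu; rewrite {1}(frame_expand (DD i (e j) u - _) Vu).
by apply: eq_bigr => k _; rewrite -bracket_f// dotBl !gamE.
Qed.

Lemma hh_sym12 i j k u : V u -> hh i j k u = hh j i k u.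
Proof.
move=> Vu; apply/eqP; rewrite -subr_eq0 !hhE -dotBl bracket_f//; apply/eqP.
exact: dot_N_df.
Qed.

Lemma derive_N i k u : V u -> DD i (N k) u =
  cr (E i u) (E k u) + cr (f u) (DD i (E k) u).
Proof.
move=> Vu; rewrite !DDE Edd ddE /N unlock crE.
apply: etrans (derive_cross (e i u) (diff_f Vu) (diff_E k Vu)) _.
by [].
Qed.

Lemma phi_cycle i j k u : phi i j k u = phi j k i u.
Proof. rewrite !phiE; exact: dot_crC. Qed.

Lemma hh_phi i j k u : V u -> hh i j k u - hh i k j u = phi i j k u.
Proof.
move=> Vu; rewrite hhE DDdd (dot_const (e i u) Vu (diff_E j) (diff_N k) (@dot_EN j k)).
rewrite -DDdd derive_N// dotDr ![dot (E j u) _]dotC dot_cr_swap -phiE.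
rewrite dot_cr_swap -NE [dot (N j u) _]dotC -hhE; ring.
Qed.

Lemma phi0 i j k u : V u -> phi i j k u = 0.
Proof.
move=> Vu; have := hh_phi i j k Vu; have := hh_phi j k i Vu; have := hh_phi k i j Vu.
rewrite -(phi_cycle i j k) (phi_cycle k i j).
rewrite (hh_sym12 k i j Vu) (hh_sym12 k j i Vu) (hh_sym12 j i k Vu).
by move: (hh _ _ _ _) (hh _ _ _ _) (hh _ _ _ _) (phi _ _ _ _) => *; lra.
Qed.

Lemma hh_sym23 i j k u : V u -> hh i j k u = hh i k j u.
Proof. by move=> Vu; apply/eqP; rewrite -subr_eq0 hh_phi// phi0. Qed.

Lemma om_anti12 i j k u : om i j k u = - om j i k u.
Proof. by rewrite !omE crC dotNl. Qed.

(** The polarised product identity with x = E_i and y = f: every term on its right contains an inner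
    product of f with a tangent vector. *)
Lemma om_anti23 i j k u : V u -> om i j k u = - om i k j u.
Proof.
move=> Vu; have := dot_cr_cr (E i u) (f u) (E j u) (E k u).
rewrite -!NE -omE ![dot (f u) _]dotC !dot_Ef//.
rewrite [dot (N j u) _]dotC -omE.
by rewrite !(mul0r, mulr0) !subr0 => /eqP; rewrite addr_eq0 => /eqP.
Qed.

Lemma cross_EE i j u : V u -> cr (E i u) (E j u) = \sum_k om i j k u *: N k u.
Proof.
move=> Vu; rewrite {1}(normal_expand (v := cr (E i u) (E j u)) Vu).
- by apply: eq_bigr => k _; rewrite omE.
- by rewrite dot_crC crC -NE dotNl dotC dot_EN ?oppr0.
- by move=> k; rewrite -phiE phi0.
Qed.

(** E_i × E_j is a unit vector in the span of the N_k. This will determine omega_012 up to sign. *)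
Lemma om_sqr_sum i j u : V u -> i != j -> \sum_k om i j k u ^+ 2 = 1.
Proof.
move=> Vu ij; have := dot_cr_cr (E i u) (E i u) (E j u) (E j u).
rewrite !dot_EE// !eqxx (negPf ij) {2 4}cross_EE// dot_sumr.
under eq_bigr => k _ do rewrite dotZr -omE -expr2.
by move: (\sum_k _) => x; rewrite !mulr1 !mulr0 !subr0 => ?; lra.
Qed.

Lemma dot_cr_EE v i j u : V u ->
  dot v (cr (E i u) (E j u)) = \sum_k om i j k u * dot v (N k u).
Proof.
by move=> Vu; rewrite cross_EE// dot_sumr; apply: eq_bigr => k _; rewrite dotZr.
Qed.

Lemma dot_DE_cr i x b c u : V u ->
  dot (DD i (E x) u) (cr (E b u) (E c u)) = \sum_k om b c k u * hh i x k u.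
Proof.
by move=> Vu; rewrite dot_cr_EE//; apply: eq_bigr => k _; rewrite hhE.
Qed.

Lemma derive_phi i a b c u : V u ->
  \sum_k om b c k u * hh i a k u + \sum_k om c a k u * hh i b k u
  + \sum_k om a b k u * hh i c k u = 0.
Proof.
move=> Vu.
have dcr : diff_on V (fun w => cr (E a w) (E b w)).
  by move=> w Vw; rewrite crE; apply: differentiable_cross; exact: diff_E.
have p0 w : V w -> dot (cr (E a w) (E b w)) (E c w) = 0.
  by move=> Vw; rewrite -phiE phi0.
have := dot_const (e i u) Vu dcr (diff_E c) p0.
have -> : dd (fun w => cr (E a w) (E b w)) (e i u) u =
    cr (DD i (E a) u) (E b u) + cr (E a u) (DD i (E b) u).
  by rewrite ddE crE !DDE; exact (derive_cross (e i u) (diff_E a Vu) (diff_E b Vu)).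
rewrite -DDdd dotDl dot_crC [dot (cr (E b u) _) _]dotC (dot_DE_cr i a b c Vu).
rewrite [dot (cr (E a u) _) _]dot_crC dot_crC [dot (cr _ _) (DD i (E b) u)]dotC.
rewrite (dot_DE_cr i b c a Vu) [dot (cr _ _) (DD i (E c) u)]dotC (dot_DE_cr i c a b Vu).
by move=> ->; rewrite addNr.
Qed.

(** * Derivatives of the normal frame *)

Lemma dot_DN_f l m u : V u -> dot (DD l (N m) u) (f u) = 0.
Proof.
move=> Vu; have Nf w : V w -> dot (N m w) (f w) = 0 by move=> Vw; rewrite dotC dot_fN.
rewrite DDdd (dot_const (e l u) Vu (diff_N m) diff_f Nf).
by rewrite -Edd dotC dot_EN// oppr0.
Qed.

Lemma dot_DN_E l m k u : V u -> dot (DD l (N m) u) (E k u) = - hh l k m u.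
Proof.
move=> Vu; have NE0 w : V w -> dot (N m w) (E k w) = 0 by move=> Vw; rewrite dotC dot_EN.
rewrite DDdd (dot_const (e l u) Vu (diff_N m) (diff_E k) NE0).
by rewrite -DDdd dotC hhE.
Qed.

(** The frame form of the normal connection, nabla^perp_X JY = G(X, Y) + J nabla_X Y. *)
Lemma dot_DN_N l m k u : V u -> dot (DD l (N m) u) (N k u) = om l m k u + gam l m k u.
Proof.
move=> Vu; rewrite derive_N// dotDl -omE; congr (_ + _).
have := dot_cr_cr (f u) (f u) (DD l (E m) u) (E k u).
rewrite f_unit// [dot (f u) (E k u)]dotC dot_Ef// -NE -gamE.
by move: (dot _ _) (gam _ _ _ _) => x y; rewrite mulr1 !mulr0 !subr0 => ?; lra.
Qed.

(** * Second derivatives of the frame and the Codazzi equation *)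

Definition dh : 'I_3 -> 'I_3 -> 'I_3 -> 'I_3 -> U -> R := locked_with frame_key
  (fun l i j m u => 'D_(e l u) (hh i j m) u).

Lemma dh_derive l i j m u : dh l i j m u = 'D_(e l u) (hh i j m) u.
Proof. by rewrite /dh unlock. Qed.


Definition hess : 'I_3 -> 'I_3 -> 'I_3 -> 'I_3 -> U -> R := locked_with frame_key
  (fun l i j m u => dot (DD l (DD i (E j)) u) (N m u)).

Lemma hessE l i j m u : hess l i j m u = dot (DD l (DD i (E j)) u) (N m u).
Proof. by rewrite /hess unlock. Qed.

Lemma dhE l i j m u : V u -> dh l i j m u = hess l i j m u
  - \sum_k gam i j k u * hh l k m u
  + \sum_k hh i j k u * (om l m k u + gam l m k u).
Proof.
move=> Vu; rewrite dh_derive hh_fun.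
apply: etrans (derive_dot (e l u) (diff_DE i j Vu) (diff_N m Vu)) _.
rewrite -!ddE -!DDdd -addrA hessE; congr (_ + _).
rewrite (parseval _ _ Vu) dot_DN_f// mulr0 add0r; congr (_ + _).
  by rewrite -sumrN; apply: eq_bigr => k _; rewrite dot_DN_E// mulrN gamE.
by apply: eq_bigr => k _; rewrite dot_DN_N// hhE.
Qed.

(** R^7 is flat, so the commutator is the derivative along the bracket [e_l, e_i], whose components
    are the antisymmetrised connection coefficients. *)
Lemma curvature_E l i j u : V u ->
  DD l (DD i (E j)) u - DD i (DD l (E j)) u =
  \sum_k (gam l i k u - gam i l k u) *: DD k (E j) u.
Proof.
move=> Vu.
have := derive_bracket hV Vu (diff_e l) (diff_e i) (diff2_E j).
rewrite -ddE.
rewrite -!DDE.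
move=> ->.
rewrite bracket_expand; last by [].
rewrite dd_sum; last exact: diff_E.
by apply: eq_bigr => k _; rewrite DDdd.
Qed.

Lemma hess_comm l i j m u : V u -> hess l i j m u = hess i l j m u
  + (\sum_k gam l i k u * hh k j m u - \sum_k gam i l k u * hh k j m u).
Proof.
move=> Vu; rewrite !hessE; have := curvature_E l i j Vu.
move: (DD l (DD i (E j)) u) (DD i (DD l (E j)) u) => x y /(canRL (subrK _)) ->.
rewrite dotDl addrC; congr (_ + _); rewrite dot_suml -sumrB.
by apply: eq_bigr => k _; rewrite dotZl mulrBl hhE.
Qed.

(* The components <(nabla h)(e_l, e_i, e_j), J e_m>. *)
Definition nab l i j m u : R := dh l i j m u
  + \sum_k hh i j k u * (om l k m u + gam l k m u)
  - \sum_k gam l i k u * hh k j m u - \sum_k gam l j k u * hh i k m u.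

(** By antisymmetry in the last two indices, the [om] and [gam] sums of [dhE] cancel the last-slot
    sum of [nab]. Of the remainder, two connection sums are exchanged by l <-> i, and [hess_comm]
    accounts for the rest. *)
Lemma codazzi l i j m u : V u -> nab l i j m u = nab i l j m u.
Proof.
move=> Vu; rewrite /nab (dhE l i j m Vu) (dhE i l j m Vu) (hess_comm l i j m Vu).
move: (hess _ _ _ _ _) => x.
have E1 a b : \sum_k hh a j k u * (om b m k u + gam b m k u) =
    - \sum_k hh a j k u * (om b k m u + gam b k m u).
  rewrite -sumrN; apply: eq_bigr => k _.
  by rewrite (om_anti23 b m k Vu) (gam_anti b m k Vu) -opprD mulrN.
rewrite (E1 i l) (E1 l i); ring.
Qed.

Lemma dh_sym12 l i j m u : V u -> dh l i j m u = dh l j i m u.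
Proof.
by move=> Vu; rewrite !dh_derive; apply: (derive_eq_on hV _ Vu) => w Vw; exact: hh_sym12.
Qed.

Lemma dh_sym23 l i j m u : V u -> dh l i j m u = dh l i m j u.
Proof.
by move=> Vu; rewrite !dh_derive; apply: (derive_eq_on hV _ Vu) => w Vw; exact: hh_sym23.
Qed.

(** * The tensor G as a cross product *)

Lemma nablaJ_cancel (p a b c : 'rV[R]_7) : dot (cross a b) p = 0 ->
  cross a b + cross p c - dot (cross a b + cross p c) p *: p
    - cross p (c - dot c p *: p) = cross a b.
Proof.
move=> abp; rewrite dotDl abp add0r dot_crossC dot_crossC cross_self dot0l scale0r.
by rewrite subr0 crossDr crossNr crossZr cross_self scaler0 oppr0 addr0 addrK.
Qed.

Lemma dot_cross_df x y u : V u -> dot (cross ('D_x f u) ('D_y f u)) (f u) = 0.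
Proof.
move=> Vu; rewrite dot_crossC crossC dotNl.
have [_ ->] := (f_lag Vu (cross (f u) ('D_y f u))).1 (ex_intro _ y erefl).
by rewrite oppr0.
Qed.

(** The product rule for f × Y has two terms; the one that differentiates Y cancels against J of the
    derivative of Y, and X × Y needs no projection, being orthogonal to f by the Lagrangian
    condition. *)
Lemma G_cr X Y u : V u -> differentiable (push f Y) u ->
  G f X Y u = cr (dd f (X u) u) (dd f (Y u) u).
Proof.
move=> Vu dY; rewrite crE !ddE /G /nablaJ /nabla_bar.
have -> : 'D_(X u) (cplx f (push f Y)) u =
    cross ('D_(X u) f u) ('D_(Y u) f u) + cross (f u) ('D_(X u) (push f Y) u).
  exact (derive_cross (X u) (diff_f Vu) dY).
exact (nablaJ_cancel ('D_(X u) (push f Y) u) (dot_cross_df (X u) (Y u) Vu)).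
Qed.

Lemma push_E i : push f (e i) = E i.
Proof. by rewrite EE. Qed.

Lemma J_N i : J f (e i) = N i.
Proof. by apply/funext => u; rewrite NE crE -push_E. Qed.

Lemma omega_om i j k u : V u -> omega f (e i) (e j) (e k) u = om i j k u.
Proof.
move=> Vu; rewrite /omega J_N G_cr//; last first.
  by rewrite push_E; exact: diff_E.
by rewrite -!Edd omE.
Qed.

(** * The induced metric and its Levi-Civita connection *)

Lemma dot_df_coord (z : U) l u : V u ->
  dot ('D_z f u) ('D_(coord_vec R l) f u) = (z *m metric f u) 0 l.
Proof.
move=> Vu; rewrite (derive_dirE z (diff_f Vu)) dot_suml mxE.
by apply: eq_bigr => i _; rewrite dotZl mxE.
Qed.

Lemma dot_E_coord v k u : V u ->
  dot v (E k u) = \sum_l e k u 0 l * dot v ('D_(coord_vec R l) f u).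
Proof.
move=> Vu; rewrite Edd ddE (derive_dirE _ (diff_f Vu)) dot_sumr.
by apply: eq_bigr => l _; rewrite dotZr.
Qed.

Lemma metric_unit u : V u -> metric f u \in unitmx.
Proof.
move=> Vu; rewrite -row_free_unit -kermx_eq0; apply/eqP/row_matrixP => i.
rewrite row0; set y := row i _.
have yg : y *m metric f u = 0 by rewrite -row_mul mulmx_ker row0.
rewrite (frame_expand y Vu) big1// => k _.
rewrite dot_E_coord// big1 ?scale0r// => l _.
by rewrite ddE dot_df_coord// yg mxE mulr0.
Qed.

Lemma metric_sym u i j : metric f u i j = metric f u j i.
Proof. by rewrite !mxE dotC. Qed.

Definition d2f u i j := 'D_(coord_vec R i) ('D_(coord_vec R j) f) u.

Lemma d2f_sym u i j : V u -> d2f u i j = d2f u j i.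
Proof.
move=> Vu; apply: derive_comm_row.
- exact: (near_open hV Vu diff_f).
- exact: diff2_f.2.
- exact: diff2_f.2.
Qed.

(** The Christoffel symbols of the first kind, in terms of the immersion. *)
Definition kos : U -> 'I_3 -> 'I_3 -> 'I_3 -> R := locked_with frame_key
  (fun u i j l => dot (d2f u i j) ('D_(coord_vec R l) f u)).

Lemma kosE u i j l : kos u i j l = dot (d2f u i j) ('D_(coord_vec R l) f u).
Proof. by rewrite /kos unlock. Qed.

Lemma kos_sym u i j l : V u -> kos u i j l = kos u j i l.
Proof. by move=> Vu; rewrite !kosE d2f_sym. Qed.

Lemma derive_metric u m i j : V u ->
  'D_(coord_vec R m) (fun w => metric f w i j) u = kos u m i j + kos u m j i.
Proof.
move=> Vu; rewrite !kosE.
rewrite (_ : (fun w => metric f w i j) =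
  fun w => dot ('D_(coord_vec R i) f w) ('D_(coord_vec R j) f w)); last first.
  by apply/funext => w; rewrite mxE.
apply: etrans (derive_dot _ (diff2_f.2 _ _ Vu) (diff2_f.2 _ _ Vu)) _.
by rewrite [X in _ + X]dotC.
Qed.

(** Each derivative of the metric is a sum of two [kos] terms; by symmetry of second derivatives
    four of the six cancel and two agree. *)
Lemma christoffelE u k i j : V u -> christoffel f u k i j =
  \sum_l invmx (metric f u) k l * kos u i j l.
Proof.
move=> Vu; rewrite /christoffel mulr_sumr; apply: eq_bigr => l _.
rewrite (derive_metric i j l Vu) (derive_metric j i l Vu) (derive_metric l i j Vu).
rewrite (kos_sym j i l Vu) (kos_sym l i j Vu) (kos_sym l j i Vu).
by rewrite mulrCA; congr (_ * _); field.
Qed.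

Lemma christoffel_metric u i j l : V u ->
  \sum_k christoffel f u k i j * metric f u k l = kos u i j l.
Proof.
move=> Vu; pose r := \col_m kos u i j m.
have chE k : christoffel f u k i j = (invmx (metric f u) *m r) k 0.
  by rewrite christoffelE// mxE; apply: eq_bigr => m _; rewrite [r _ _]mxE.
transitivity ((metric f u *m (invmx (metric f u) *m r)) l 0).
  by rewrite mxE; apply: eq_bigr => k _; rewrite chE mulrC metric_sym.
by rewrite mulKVmx ?metric_unit// mxE.
Qed.

Lemma derive_push X Y u : V u -> diff_on V Y ->
  'D_(X u) (push f Y) u = 'D_('D_(X u) Y u) f u
    + \sum_i \sum_j (X u 0 i * Y u 0 j) *: d2f u i j.
Proof.
move=> Vu dY; apply: etrans (derive_along hV (X u) Vu dY diff2_f) _; congr (_ + _).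
rewrite exchange_big; apply: eq_bigr => j _.
have -> : 'D_(X u) ('D_(delta_mx 0 j) f) u = \sum_i X u 0 i *: d2f u i j.
  by rewrite (derive_dirE _ (diff2_f.2 _ _ Vu)).
by rewrite scaler_sumr; apply: eq_bigr => i _; rewrite scalerA mulrC.
Qed.

(** The tangential half of the Gauss formula: the connection built from Christoffel symbols is the
    tangential part of the flat derivative. *)
Lemma dot_push_nabla X Y u k : V u -> diff_on V Y ->
  dot (dd f (nabla f X Y u) u) (E k u) = dot ('D_(X u) (push f Y) u) (E k u).
Proof.
move=> Vu dY; rewrite !dot_E_coord//; apply: eq_bigr => l _; congr (_ * _).
rewrite ddE dot_df_coord// derive_push// dotDl dot_df_coord// /nabla mulmxDl mxE.
congr (_ + _); rewrite mxE dot_suml.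
under eq_bigr do rewrite mxE mulr_suml.
rewrite exchange_big; apply: eq_bigr => i _; rewrite dot_suml.
under eq_bigr do rewrite mulr_suml.
rewrite exchange_big; apply: eq_bigr => j _ /=.
rewrite dotZl -kosE -christoffel_metric// mulr_sumr; apply: eq_bigr => m _.
by ring.
Qed.

(** * The second fundamental form, its derivative and T in the frame *)

Lemma sff_expand X Y u : V u -> diff_on V Y ->
  sff f X Y u = \sum_k dot ('D_(X u) (push f Y) u) (N k u) *: N k u.
Proof.
move=> Vu dY.
set c := 'D_(X u) (push f Y) u.
have sE : sff f X Y u = c - dot c (f u) *: f u - dd f (nabla f X Y u) u.
  by rewrite ddE.
rewrite sE; set v := _ - _ - _.
have vf : dot v (f u) = 0.
  by rewrite /v !dotBl dotZl f_unit// mulr1 subrr (dot_f_df _ Vu) subr0.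
have vE k : dot v (E k u) = 0.
  rewrite /v !dotBl dotZl dot_push_nabla// [dot (f u) _]dotC dot_Ef// mulr0 subr0.
  by rewrite subrr.
rewrite (normal_expand Vu vf vE); apply: eq_bigr => k _; congr (_ *: _).
by rewrite /v !dotBl dotZl dot_fN// mulr0 subr0 (dot_N_df k _ Vu) subr0.
Qed.

Lemma dot_sumN (c : 'I_3 -> R) m u : V u ->
  dot (\sum_k c k *: N k u) (N m u) = c m.
Proof.
move=> Vu; rewrite dot_suml (bigD1 m)//= big1 => [|k km].
  by rewrite dotZl dot_NN// eqxx mulr1 addr0.
by rewrite dotZl dot_NN// (negPf km) mulr0.
Qed.

Lemma dot_sff_N X Y m u : V u -> diff_on V Y ->
  dot (sff f X Y u) (N m u) = dot (dd (push f Y) (X u) u) (N m u).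
Proof. by move=> Vu dY; rewrite sff_expand// dot_sumN// ddE. Qed.

Lemma dd_E i j u : dd (push f (e j)) (e i u) u = DD i (E j) u.
Proof. by rewrite push_E DDdd. Qed.

Lemma sff_frame i j u : V u -> sff f (e i) (e j) u = \sum_k hh i j k u *: N k u.
Proof.
move=> Vu; rewrite (sff_expand _ Vu (diff_e j)); apply: eq_bigr => k _.
by rewrite -ddE dd_E hhE.
Qed.

Lemma h_c_hh i j k u : V u -> h_c f e u i j k = hh i j k u.
Proof. by move=> Vu; rewrite /h_c J_N (dot_sff_N _ _ Vu (diff_e j)) dd_E hhE. Qed.

Lemma nabla_frame i j u : V u ->
  nabla f (e i) (e j) u = \sum_k gam i j k u *: e k u.
Proof.
move=> Vu; rewrite (frame_expand (nabla f (e i) (e j) u) Vu).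
apply: eq_bigr => k _; congr (_ *: _).
by rewrite (dot_push_nabla _ _ Vu (diff_e j)) -ddE dd_E gamE.
Qed.

Lemma diff_comb n (c : 'I_3 -> U -> R) (g : 'I_3 -> U -> 'rV[R]_n.+1) :
  (forall k, diff_on V (c k)) -> (forall k, diff_on V (g k)) ->
  diff_on V (fun u => \sum_k c k u *: g k u).
Proof.
move=> dc dg; apply: diff_on_sum => k u Vu.
by apply: differentiable_scale; [exact: dc|exact: dg].
Qed.

Lemma derive_comb n (c : 'I_3 -> U -> R) (g : 'I_3 -> U -> 'rV[R]_n.+1) u v :
  V u -> (forall k, diff_on V (c k)) -> (forall k, diff_on V (g k)) ->
  dd (fun u => \sum_k c k u *: g k u) v u =
  \sum_k ('D_v (c k) u *: g k u + c k u *: dd (g k) v u).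
Proof.
move=> Vu dc dg; rewrite ddE.
have dcg k : differentiable (fun w => c k w *: g k w) u.
  by apply: differentiable_scale; [exact: dc|exact: dg].
apply: etrans (derive_sum_row v dcg) _; apply: eq_bigr => k _.
rewrite ddE; exact (derive_scale v (dc k u Vu) (dg k u Vu)).
Qed.

Lemma diff_nabla_frame i j : diff_on V (nabla f (e i) (e j)).
Proof.
have H : eq_on V (fun u => \sum_k gam i j k u *: e k u) (nabla f (e i) (e j)).
  by move=> u Vu; rewrite nabla_frame.
by apply: (diff_on_eq hV H); apply: diff_comb => k; [exact: diff_gam|exact: diff_e].
Qed.

Lemma dd_eq_on n (g h : U -> 'rV[R]_n.+1) v u : V u -> eq_on V g h ->
  dd g v u = dd h v u.
Proof. move=> Vu gh; rewrite !ddE; exact (derive_eq_on hV v Vu gh). Qed.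

Lemma push_comb (c : 'I_3 -> R) u : V u ->
  dd f (\sum_k c k *: e k u) u = \sum_k c k *: E k u.
Proof.
move=> Vu; rewrite dd_sum; last exact: diff_f.
by apply: eq_bigr => k _; rewrite Edd.
Qed.

Lemma dot_nabla_perp l i j m u : V u ->
  dot (nabla_perp f (e l) (sff f (e i) (e j)) u) (N m u) =
  dh l i j m u + \sum_k hh i j k u * (om l k m u + gam l k m u).
Proof.
move=> Vu.
have -> : nabla_perp f (e l) (sff f (e i) (e j)) u =
    dd (sff f (e i) (e j)) (e l u) u
    - dot (dd (sff f (e i) (e j)) (e l u) u) (f u) *: f u
    - dd f (tan_part f (nabla_bar f (e l) (sff f (e i) (e j))) u) u by rewrite !ddE.
rewrite (dd_eq_on (e l u) Vu (fun w Vw => sff_frame i j Vw)).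
set c := dd _ _ _; rewrite !dotBl dotZl dot_fN// mulr0 subr0 (dot_N_df m _ Vu) subr0.
rewrite /c derive_comb//; [|by move=> k; exact: diff_hh|by move=> k; exact: diff_N].
rewrite big_split dotDl /=; congr (_ + _).
  by rewrite dot_sumN// dh_derive.
rewrite dot_suml; apply: eq_bigr => k _.
by rewrite dotZl -DDdd dot_DN_N.
Qed.

Lemma dot_sff_nablal l i j m u : V u ->
  dot (sff f (nabla f (e l) (e i)) (e j) u) (N m u) =
  \sum_k gam l i k u * hh k j m u.
Proof.
move=> Vu; rewrite (dot_sff_N _ _ Vu (diff_e j)) push_E nabla_frame//.
rewrite dd_sum; last exact: diff_E.
rewrite dot_suml; apply: eq_bigr => k _.
by rewrite dotZl -DDdd hhE.
Qed.

Lemma dot_sff_nablar l i j m u : V u ->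
  dot (sff f (e i) (nabla f (e l) (e j)) u) (N m u) =
  \sum_k gam l j k u * hh i k m u.
Proof.
move=> Vu; rewrite (dot_sff_N _ _ Vu (diff_nabla_frame l j)).
have H : eq_on V (push f (nabla f (e l) (e j))) (fun w => \sum_k gam l j k w *: E k w).
  by move=> w Vw; rewrite -push_comb// -nabla_frame// ddE.
rewrite (dd_eq_on (e i u) Vu H).
rewrite derive_comb//; [|by move=> k; exact: diff_gam|by move=> k; exact: diff_E].
rewrite dot_suml; apply: eq_bigr => k _.
by rewrite dotDl !dotZl dot_EN// mulr0 add0r -DDdd hhE.
Qed.

Lemma dotB3 n (a b c w : 'rV[R]_n) :
  dot (a - b - c) w = dot a w - dot b w - dot c w.
Proof. by rewrite !dotBl. Qed.

Lemma nabla_sff_nab l i j m u : V u ->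
  dot (nabla_sff f (e l) (e i) (e j) u) (N m u) = nab l i j m u.
Proof.
move=> Vu; apply: etrans (dotB3 _ _ _ _) _.
exact (f_equal3 (fun x y z => x - y - z) (dot_nabla_perp l i j m Vu)
  (dot_sff_nablal l i j m Vu) (dot_sff_nablar l i j m Vu)).
Qed.

Lemma shape_frame i m u : V u ->
  Defs.shape f (J f (e m)) (e i) u = \sum_k hh i k m u *: e k u.
Proof.
move=> Vu; rewrite (frame_expand (Defs.shape f (J f (e m)) (e i) u) Vu).
apply: eq_bigr => k _; congr (_ *: _).
rewrite dot_E_coord//.
(* [sharp] inverts the metric, so pairing with a coordinate vector returns the covector from which
   [shape] was built. *)
have shE l : dot (dd f (Defs.shape f (J f (e m)) (e i) u) u) ('D_(coord_vec R l) f u) =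
    dot (dd ('D_(coord_vec R l) f) (e i u) u) (N m u).
  rewrite ddE dot_df_coord// /Defs.shape /sharp mulmxKV ?metric_unit// mxE J_N.
  rewrite dot_sff_N//.
rewrite (eq_bigr (fun l => e k u 0 l *
    dot (dd ('D_(coord_vec R l) f) (e i u) u) (N m u))); last first.
  by move=> l _; congr (_ * _); exact: shE.
rewrite hhE DDdd EE.
(* Differentiating the coordinates of e_k yields only a tangent vector, which N_m does not see. *)
have -> : dd (along (e k) f) (e i u) u = dd f ('D_(e i u) (e k) u) u
    + \sum_l e k u 0 l *: dd ('D_(coord_vec R l) f) (e i u) u.
  rewrite !ddE (eq_bigr (fun l => e k u 0 l *: 'D_(e i u) ('D_(coord_vec R l) f) u));
    last by move=> l _; rewrite ddE.
  exact (derive_along hV (e i u) Vu (diff_e k) diff2_f).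
rewrite dotDl (dot_N_df m _ Vu) add0r dot_suml.
by apply: eq_bigr => l _; rewrite dotZl.
Qed.

Lemma G_shape l i j m u : V u ->
  dot (G f (e l) (Defs.shape f (J f (e j)) (e i)) u) (N m u) =
  \sum_a hh i a j u * om l a m u.
Proof.
move=> Vu.
have H : eq_on V (fun w => \sum_k hh i k j w *: E k w)
    (push f (Defs.shape f (J f (e j)) (e i))).
  by move=> w Vw; rewrite -push_comb// -shape_frame// ddE.
have dp : diff_on V (push f (Defs.shape f (J f (e j)) (e i))).
  by apply: (diff_on_eq hV H); apply: diff_comb => k; [exact: diff_hh|exact: diff_E].
rewrite (G_cr _ Vu (dp _ Vu)) -Edd shape_frame// push_comb// cr_sumr dot_suml.
by apply: eq_bigr => a _; rewrite crZr dotZl omE.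
Qed.

Lemma T_c_frame l i j m u : V u -> T_c f e u l i j m = nab l i j m u
  - 4^-1 * (\sum_a hh i a j u * om l a m u + \sum_a hh j a l u * om i a m u
            + \sum_a hh l a i u * om j a m u).
Proof.
move=> Vu; rewrite /T_c J_N; apply: etrans (dotBl _ _ _) _.
apply: f_equal2; first exact: nabla_sff_nab.
apply: f_equal; apply: etrans (dotZl _ _ _) _; apply: f_equal.
apply: etrans (dotDl _ _ _) _; apply: f_equal2; last exact: G_shape.
by apply: etrans (dotDl _ _ _) _; apply: f_equal2; exact: G_shape.
Qed.

Lemma omega_c_om i j k u : V u -> omega_c f e u i j k = om i j k u.
Proof. by move=> Vu; rewrite /omega_c omega_om. Qed.

(** * Orientation and minimality *)

Lemma om_012 u : V u -> om i0 i1 i2 u = 1.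
Proof.
move=> Vu.
have o0 : om i0 i1 i0 u = 0.
  have := om_anti12 i0 i1 i0 u; have := om_anti23 i1 i0 i0 Vu.
  by move: (om i0 i1 i0 u) (om i1 i0 i0 u) => x y *; lra.
have o1 : om i0 i1 i1 u = 0.
  by have := om_anti23 i0 i1 i1 Vu; move: (om i0 i1 i1 u) => x *; lra.
have := om_sqr_sum Vu (isT : i0 != i1); rewrite sum3E o0 o1 expr0n /= !add0r.
(* Positivity of the frame excludes the root -1. *)
have : 0 < om i0 i1 i2 u.
  have [_ _ /(_ u Vu)] := he; rewrite omega_om//.
  have -> : inord 0 = i0 by apply: val_inj; rewrite /= inordK.
  have -> : inord 1 = i1 by apply: val_inj; rewrite /= inordK.
  by have -> : inord 2 = i2 by apply: val_inj; rewrite /= inordK.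
by move=> o_gt0 /eqP; rewrite sqrp_eq1 ?ltW// => /eqP.
Qed.

Lemma om_eps i j k u : V u -> om i j k u = eps R i j k.
Proof.
move=> Vu; rewrite -(@epsE R (fun i j k => om i j k u))//.
- by move=> *; exact: om_anti12.
- by move=> *; exact: om_anti23.
- exact: om_012.
Qed.

Lemma hh_tr i u : V u -> \sum_k hh i k k u = 0.
Proof.
(* With [om] equal to [eps], each of the three sums keeps only its diagonal term, and together they
   are the trace. *)
move=> Vu; have := derive_phi i i0 i1 i2 Vu.
rewrite !sum3E !(om_eps _ _ _ Vu) /eps /=.
move: (hh i i0 i0 u) (hh i i1 i1 u) (hh i i2 i2 u) => x y z.
move: (hh i i0 i1 u) (hh i i0 i2 u) (hh i i1 i0 u) => x' y' z'.
by move: (hh i i1 i2 u) (hh i i2 i0 u) (hh i i2 i1 u) => x'' y'' z'' ?; lra.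
Qed.

Lemma dh_tr l i u : V u -> \sum_k dh l i k k u = 0.
Proof.
move=> Vu; rewrite (eq_bigr (fun k => 'D_(e l u) (hh i k k) u)); last first.
  by move=> k _; rewrite dh_derive.
apply: etrans (esym (derive_sumd (e l u) (fun k => diff_hh i k k Vu))) _.
exact (derive_cst_on hV (e l u) Vu (fun w Vw => hh_tr i Vw)).
Qed.

(** * The two inequalities at a point of the immersion *)

Section AtPoint.
Variable u : U.
Hypothesis Vu : V u.
Let h := h_c f e u.
Let T := T_c f e u.

Lemma h_c12 i j k : h i j k = h j i k.
Proof. by rewrite /h !h_c_hh//; exact: hh_sym12. Qed.

Lemma h_c23 i j k : h i j k = h i k j.
Proof. by rewrite /h !h_c_hh//; exact: hh_sym23. Qed.

Lemma h_c_tr i : \sum_k h i k k = 0.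
Proof.
by rewrite -[RHS](hh_tr i Vu); apply: eq_bigr => k _; rewrite /h h_c_hh.
Qed.

Let D l i j k := dh l i j k u.
Let n l i j k := nab l i j k u.
Let g l i k := gam l i k u.

Lemma T_c_ttensor : T = ttensor h n.
Proof.
apply/funext => l; apply/funext => i; apply/funext => j; apply/funext => m.
rewrite /T T_c_frame// /ttensor; congr (_ - _ * (_ + _ + _));
  by apply: eq_bigr => a _; rewrite om_eps// /h h_c_hh.
Qed.

Lemma nab_expand l i j m : n l i j m = D l i j m
  + \sum_k h i j k * (eps R l k m + g l k m)
  - \sum_k g l i k * h k j m - \sum_k g l j k * h i k m.
Proof.
rewrite /n /nab; congr (_ + _ - _ - _); apply: eq_bigr => k _.
- by rewrite om_eps// /h h_c_hh.
- by rewrite /h h_c_hh.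
- by rewrite /h h_c_hh.
Qed.

Let D23 l i j k : D l i j k = D l j i k. Proof. exact: dh_sym12. Qed.
Let D34 l i j k : D l i j k = D l i k j. Proof. exact: dh_sym23. Qed.
Let D_tr l i : \sum_k D l i k k = 0. Proof. exact: dh_tr. Qed.
Let g_anti l i k : g l i k = - g l k i. Proof. exact: gam_anti. Qed.
Let n12 l i j m : n l i j m = n i l j m. Proof. exact: codazzi. Qed.

Lemma T_c12 l i j k : T l i j k = T i l j k.
Proof. by rewrite T_c_ttensor; exact: (ttensor12 h_c12 h_c23 n12). Qed.

Lemma T_c23 l i j k : T l i j k = T l j i k.
Proof. by rewrite T_c_ttensor; exact: (ttensor23 h_c12 h_c23 D23 nab_expand). Qed.

Lemma T_c34 l i j k : T l i j k = T l i k j.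
Proof.
by rewrite T_c_ttensor; exact: (ttensor34 h_c12 h_c23 h_c_tr D34 g_anti nab_expand).
Qed.

Lemma T_c_tr l i : \sum_k T l i k k = 0.
Proof.
by rewrite T_c_ttensor;
  exact: (ttensor_tr h_c12 h_c23 h_c_tr D23 D34 D_tr g_anti nab_expand).
Qed.

Lemma A_mxE i j : A_mx f e u i j = sym_curl (contract h T) i j.
Proof.
have wE : omega_c f e u = eps R.
  apply/funext => i'; apply/funext => j'; apply/funext => k'.
  by rewrite omega_c_om// om_eps.
by rewrite mxE /W_c wE.
Qed.

Lemma S_mxE i j : S_mx f e u i j = gram h i j.
Proof. by rewrite mxE. Qed.

Lemma lagrangian_inequalities :
  mx_inner (A_mx f e u) (A_mx f e u) <= 5 / 12 * s_inv f e u * T_norm2 f e u /\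
  mx_inner (A_mx f e u) (S_mx f e u) ^+ 2 <=
  1 / 12 * (- 4 * s_inv f e u ^+ 3 + 17 * (s_inv f e u * q_inv f e u)
    - 15 * r_inv f e u) * T_norm2 f e u.
Proof.
have AA : mx_inner (A_mx f e u) (A_mx f e u) =
    inner2 (sym_curl (contract h T)) (sym_curl (contract h T)).
  by apply: eq_bigr => i _; apply: eq_bigr => j _; rewrite A_mxE.
have AS : mx_inner (A_mx f e u) (S_mx f e u) =
    inner2 (sym_curl (contract h T)) (gram h).
  by apply: eq_bigr => i _; apply: eq_bigr => j _; rewrite A_mxE S_mxE.
have SE : s_inv f e u = tr2 (gram h) by apply: eq_bigr => i _; rewrite S_mxE.
have SSE i j : (S_mx f e u *m S_mx f e u) i j = mul2 (gram h) (gram h) i j.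
  by rewrite mxE; apply: eq_bigr => k _; rewrite !S_mxE.
have QE : q_inv f e u = tr2 (mul2 (gram h) (gram h)).
  by apply: eq_bigr => i _; rewrite SSE.
have RE : r_inv f e u = tr2 (mul2 (mul2 (gram h) (gram h)) (gram h)).
  by apply: eq_bigr => i _; rewrite mxE; apply: eq_bigr => k _; rewrite SSE S_mxE.
have TE : T_norm2 f e u = inner4 T T.
  do 4!(apply: eq_bigr => ? _); exact: expr2.
rewrite AA AS SE QE RE TE; split.
- exact: (sym_curl_norm_le h_c12 h_c23 h_c_tr T_c12 T_c23 T_c34 T_c_tr).
- exact: (sym_curl_gram_le h_c12 h_c23 h_c_tr T_c12 T_c23 T_c34 T_c_tr).
Qed.

End AtPoint.

End MovingFrame.

Theorem lemma3p3 (R : realType) (M : topologicalType)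
    (atlas : set (chart R M 2)) (F : M -> 'rV[R]_7)
    (hM : smooth_manifold atlas) (hF : lagrangian_immersion atlas F)
    (p : M) (c : chart R M 2) (hc : atlas c) (hp : chart_dom c p)
    (V : set 'rV[R]_3) (hV : open V) (hVc : V `<=` chart_img c)
    (hVp : V (chart_map c p)) (e : frame R)
    (he : oriented_orthonormal_frame (F \o chart_inv c) V e) :
  let f := F \o chart_inv c in
  let u := chart_map c p in
  let A := A_mx f e u in
  let S := S_mx f e u in
  let s := s_inv f e u in
  let q := q_inv f e u in
  let r := r_inv f e u in
  let T2 := T_norm2 f e u in
  mx_inner A A <= 5 / 12 * s * T2 /\
  mx_inner A S ^+ 2
    <= 1 / 12 * (- 4 * s ^+ 3 + 17 * (s * q) - 15 * r) * T2.
Proof.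
have [F1 /(_ c hc)[fS fI]] := hF.
apply: (lagrangian_inequalities hV _ _ _ he hVp).
- by move=> vs u Vu; apply: fS; exact: hVc.
- by move=> u _; exact: F1.
- by move=> u Vu; have [] := fI u (hVc _ Vu).
Qed.
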